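(* There is a constant $K>1$ such that for every integer $n\ge 2$ and every real $t$ with $$\sqrt{n}\le t\le \frac{2^{\sqrt{2\log_2 n}}}{\sqrt{\log_2 n}}\,n,$$ there is a connected graph $H$ with $n$ vertices whose geometric pebbling threshold lies between $t/K$ and $Kt$.
   Context: Pebbling: a distribution on a graph assigns a nonnegative integer number of pebbles to each vertex. A pebbling move removes two pebbles from a vertex having at least two pebbles and adds one pebble to an adjacent vertex. A vertex is pebblable if some sequence of pebbling moves from the distribution ends with at least one pebble on it; a distribution is solvable if every vertex is pebblable. The geometric distribution on $\{0,1,2,\dots\}$ with parameter $0<p\le 1$ assigns probability $p(1-p)^k$ to $k$. For a graph $H$ with $n>0$ vertices, the geometric pebbling threshold of $H$ is the unique positive real $x$ such that, if an independent geometrically distributed number of pebbles with parameter $(1+x/n)^{-1}$ is placed on each vertex of $H$, the probability that the distribution is solvable equals $\tfrac12$. *)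

(* Defs.v *)
From Stdlib Require Import Reals Lra Lia Arith List Relations ClassicalEpsilon.
Import ListNotations.
Open Scope R_scope.

(* A graph on the vertex set {0,...,n-1} is given by a boolean adjacency
   relation adj : nat -> nat -> bool (values outside {0..n-1} are ignored). *)

Definition simple_graph (n : nat) (adj : nat -> nat -> bool) : Prop :=
  forall u v, (u < n)%nat -> (v < n)%nat ->
    adj u v = adj v u /\ adj u u = false.

Definition edge_in (n : nat) (adj : nat -> nat -> bool) (a b : nat) : Prop :=
  (a < n)%nat /\ (b < n)%nat /\ adj a b = true.

Definition connected (n : nat) (adj : nat -> nat -> bool) : Prop :=
  forall u v, (u < n)%nat -> (v < n)%nat ->
    clos_refl_trans nat (edge_in n adj) u v.

(* Distributions: d : nat -> nat, d i = number of pebbles on vertex i < n. *)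
Definition distribution := nat -> nat.

Definition pebbling_move (n : nat) (adj : nat -> nat -> bool)
  (d d' : distribution) : Prop :=
  exists u v, edge_in n adj u v /\ (2 <= d u)%nat /\
    d' = (fun w => if Nat.eqb w u then (d u - 2)%nat
                   else if Nat.eqb w v then (d w + 1)%nat else d w).

Definition pebblable (n : nat) (adj : nat -> nat -> bool)
  (d : distribution) (r : nat) : Prop :=
  exists d', clos_refl_trans distribution (pebbling_move n adj) d d' /\
             (1 <= d' r)%nat.

Definition solvable (n : nat) (adj : nat -> nat -> bool)
  (d : distribution) : Prop :=
  forall r, (r < n)%nat -> pebblable n adj d r.

Fixpoint box_dists (k M : nat) : list distribution :=
  match k with
  | O => [fun _ => O]
  | S k' =>
      flat_map (fun f => map (fun a => fun i => if Nat.eqb i k' then a else f i)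
                             (seq 0 (S M)))
               (box_dists k' M)
  end.

(* Probability of a distribution under i.i.d. geometric(p) pebbles on the
   n vertices: prod_{i<n} p (1-p)^(d i). *)
Fixpoint geom_weight (k : nat) (p : R) (d : distribution) : R :=
  match k with
  | O => 1
  | S k' => geom_weight k' p d * (p * (1 - p) ^ (d k'))
  end.

Definition indicator (P : Prop) : R :=
  if excluded_middle_informative P then 1 else 0.

Definition geom_param (n : nat) (x : R) : R := / (1 + x / INR n).

Definition solv_prob_partial (n : nat) (adj : nat -> nat -> bool)
  (x : R) (M : nat) : R :=
  fold_right Rplus 0
    (map (fun d => geom_weight n (geom_param n x) d * indicator (solvable n adj d))
         (box_dists n M)).

(* [solv_prob n adj x P]: the probability that the random geometric
   distribution is solvable equals P (the sum of the nonnegative series,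
   i.e. the supremum of the partial sums over growing boxes). *)
Definition solv_prob (n : nat) (adj : nat -> nat -> bool) (x P : R) : Prop :=
  is_lub (fun s => exists M, s = solv_prob_partial n adj x M) P.

Definition is_geom_threshold (n : nat) (adj : nat -> nat -> bool) (x : R) : Prop :=
  0 < x /\ solv_prob n adj x (1/2) /\
  (forall y, 0 < y -> solv_prob n adj y (1/2) -> y = x).

Definition log2 (x : R) : R := ln x / ln 2.

(* Main.v *)
Require Import Defs.
From Stdlib Require Import Reals Lra Lia Arith List Relations.
From Stdlib Require Import Classical ClassicalEpsilon FunctionalExtensionality.
Open Scope R_scope.

(* A vertex with enough pebbles solves a connected graph, so the probability of insolvability is
   a finite sum, strictly decreasing and continuous in the geometric parameter; hence thresholds
   exist and can be located by estimating a single probability.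

   For [sqrt n <= t <= n], take a path of [L] edges from a hub carrying all remaining vertices as
   leaves, with [2 ^ L] about [t ^ 2 / n]: the pairs of pebbles on the leaves number about
   [t ^ 2 / n], and the far end needs [2 ^ L] of them.

   For [t >= n], a spider with legs of length about [2 log2 n] has threshold at least of the order
   of the largest [t] allowed, because with high probability some leg is nearly empty near its tip.
   Its edges are completed one by one to those of the complete graph, whose threshold is at most
   [3 n], always joining vertices at distance two. Such a step divides the threshold by a bounded
   factor: without the new edge, doubling the pebbles suffices, and halving a geometric variable
   of ratio [sqrt q] gives one of ratio [q]. Some intermediate graph therefore has threshold of
   order [t]. *)

(** The upper end of the range is where nearly empty legs stop being likely. Let the vertex at
    distance [i < k] from a tip hold at most [2 ^ i / (8 k)] pebbles: together these vertices carry
    weight at most [1 / 8] towards the tip. If the mean per vertex is [l = 2 ^ k / (8 k)], this has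
    probability about [2 ^ (i - k)] at distance [i], hence about [2 ^ (- k ^ 2 / 2)] for the leg up
    to lower-order terms in the exponent. With roughly [n / log2 n] legs, some leg complies as long
    as [k] stays a little below [sqrt (2 log2 n)], and then [l] is of the order of the largest
    [t / n] allowed.

    Adding an edge is delicate because rerouting each use of it doubles the price, and a pebble may
    descend from a long chain of uses. Trees of moves settle this: a subtree that crosses the edge
    already yields a pebble at either end, so a second crossing on the same branch can be cut out
    and one doubling is enough. The halving bounds [x] by a multiple of [x' + n], not of [x'] alone,
    which is a bounded factor only for thresholds of order at least [n]; smaller [t] need graphs of
    their own. *)

(** * Finite sums and products of reals *)

Fixpoint rsum (k : nat) (g : nat -> R) : R :=
  match k with O => 0 | S k' => rsum k' g + g k' end.

Fixpoint rprod (k : nat) (g : nat -> R) : R :=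
  match k with O => 1 | S k' => rprod k' g * g k' end.

Lemma rsum_le k f g : (forall i, (i < k)%nat -> f i <= g i) -> rsum k f <= rsum k g.
Proof.
  induction k as [|k IH]; intros H; simpl; [lra|].
  apply Rplus_le_compat; [apply IH; intros; apply H; lia | apply H; lia].
Qed.

Lemma rsum_ext k f g : (forall i, (i < k)%nat -> f i = g i) -> rsum k f = rsum k g.
Proof.
  intros H; apply Rle_antisym; apply rsum_le; intros i Hi; rewrite (H i Hi); lra.
Qed.

Lemma rsum_plus k f g : rsum k (fun i => f i + g i) = rsum k f + rsum k g.
Proof. induction k as [|k IH]; simpl; [|rewrite IH]; lra. Qed.

Lemma rsum_scal k c f : rsum k (fun i => c * f i) = c * rsum k f.
Proof. induction k as [|k IH]; simpl; [|rewrite IH]; lra. Qed.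

Lemma rsum_const k c : rsum k (fun _ => c) = INR k * c.
Proof. induction k as [|k IH]; [simpl; lra|]. rewrite S_INR; simpl; rewrite IH; lra. Qed.

Lemma rsum_nonneg k f : (forall i, (i < k)%nat -> 0 <= f i) -> 0 <= rsum k f.
Proof.
  intros H. replace 0 with (rsum k (fun _ => 0)) by (rewrite rsum_const; lra).
  now apply rsum_le.
Qed.

Lemma rsum_app a b f : rsum (a + b) f = rsum a f + rsum b (fun i => f (a + i)%nat).
Proof.
  induction b as [|b IH]; [rewrite Nat.add_0_r; simpl; lra|].
  rewrite Nat.add_succ_r; simpl; rewrite IH; lra.
Qed.

Lemma rsum_ge_term k f v :
  (forall i, (i < k)%nat -> 0 <= f i) -> (v < k)%nat -> f v <= rsum k f.
Proof.
  induction k as [|k IH]; intros H Hv; [lia|]; simpl.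
  assert (0 <= rsum k f) by (apply rsum_nonneg; intros; apply H; lia).
  destruct (Nat.eq_dec v k) as [->|Hne]; [lra|].
  assert (f v <= rsum k f) by (apply IH; [intros; apply H|]; lia).
  assert (0 <= f k) by (apply H; lia). lra.
Qed.

Lemma rsum_geom k c r : 0 <= c -> 0 <= r < 1 -> rsum k (fun i => c * r ^ i) <= c / (1 - r).
Proof.
  intros Hc Hr.
  assert (E : rsum k (fun i => c * r ^ i) = c / (1 - r) * (1 - r ^ k)).
  { induction k as [|k IH]; simpl; [lra|]. rewrite IH. field. lra. }
  rewrite E.
  assert (0 <= r ^ k) by (apply pow_le; lra).
  assert (0 <= c / (1 - r)) by (apply Rle_mult_inv_pos; lra). nra.
Qed.

Lemma rprod_nonneg k f : (forall i, (i < k)%nat -> 0 <= f i) -> 0 <= rprod k f.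
Proof.
  induction k as [|k IH]; intros H; simpl; [lra|].
  apply Rmult_le_pos; [apply IH; intros; apply H; lia | apply H; lia].
Qed.

Lemma rprod_le k f g : (forall i, (i < k)%nat -> 0 <= f i <= g i) -> rprod k f <= rprod k g.
Proof.
  induction k as [|k IH]; intros H; simpl; [lra|].
  apply Rmult_le_compat; try apply H; try lia.
  - apply rprod_nonneg; intros; apply H; lia.
  - apply IH; intros; apply H; lia.
Qed.

Lemma rprod_ext k f g : (forall i, (i < k)%nat -> f i = g i) -> rprod k f = rprod k g.
Proof.
  induction k as [|k IH]; intros H; simpl; [reflexivity|].
  rewrite IH, (H k); auto.
Qed.

Lemma rprod_const k c : rprod k (fun _ => c) = c ^ k.
Proof. induction k as [|k IH]; simpl; [|rewrite IH]; lra. Qed.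

Lemma rprod_app a b f : rprod (a + b) f = rprod a f * rprod b (fun i => f (a + i)%nat).
Proof.
  induction b as [|b IH]; [rewrite Nat.add_0_r; simpl; lra|].
  rewrite Nat.add_succ_r; simpl; rewrite IH; lra.
Qed.

(** The union bound for independent events of probabilities [e i]; for constant [e] it is
    Bernoulli's inequality. *)
Lemma rprod_one_sub k e :
  (forall i, (i < k)%nat -> 0 <= e i <= 1) -> 1 - rsum k e <= rprod k (fun i => 1 - e i).
Proof.
  induction k as [|k IH]; intros H; simpl; [lra|].
  assert (IH' := IH (fun i Hi => H i (Nat.lt_lt_succ_r _ _ Hi))).
  assert (0 <= e k <= 1) by (apply H; lia).
  assert (0 <= rsum k e) by (apply rsum_nonneg; intros; apply H; lia).
  assert (0 <= rprod k (fun i => 1 - e i) ).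
  { apply rprod_nonneg; intros i Hi; destruct (H i); [lia|lra]. }
  assert (rprod k (fun i => 1 - e i) <= rprod k (fun _ => 1)).
  { apply rprod_le; intros i Hi; destruct (H i); [lia|lra]. }
  rewrite rprod_const, pow1 in *. nra.
Qed.

Lemma rprod_eq_1 k f : (forall i, (i < k)%nat -> f i = 1) -> rprod k f = 1.
Proof. intros H. rewrite (rprod_ext k f (fun _ => 1)); auto. rewrite rprod_const; apply pow1. Qed.

Lemma rprod_eq_0 k f v : (v < k)%nat -> f v = 0 -> rprod k f = 0.
Proof.
  induction k as [|k IH]; intros Hv E; [lia|]; simpl.
  destruct (Nat.eq_dec v k) as [<-|]; [rewrite E; lra|]. rewrite IH by (auto; lia); lra.
Qed.

(** * Geometric expectations over boxes *)

(* [gsum M q g] is the sum of [(1 - q) * q ^ a * g a] over [a <= M]. *)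
Fixpoint gsum (M : nat) (q : R) (g : nat -> R) : R :=
  match M with
  | O => (1 - q) * g O
  | S M' => (1 - q) * g O + q * gsum M' q (fun a => g (S a))
  end.

Lemma gsum_le M q f g : 0 <= q <= 1 -> (forall a, f a <= g a) -> gsum M q f <= gsum M q g.
Proof.
  intros Hq; revert f g; induction M as [|M IH]; intros f g H; simpl.
  - apply Rmult_le_compat_l; [lra|auto].
  - apply Rplus_le_compat; apply Rmult_le_compat_l; auto; lra.
Qed.

Lemma gsum_ext M q f g : (forall a, f a = g a) -> gsum M q f = gsum M q g.
Proof. intros H; f_equal; extensionality a; auto. Qed.

Lemma gsum_scal M q c f : gsum M q (fun a => c * f a) = c * gsum M q f.
Proof. revert f; induction M as [|M IH]; intros f; simpl; [|rewrite IH]; lra. Qed.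

Lemma gsum_plus M q f g : gsum M q (fun a => f a + g a) = gsum M q f + gsum M q g.
Proof. revert f g; induction M as [|M IH]; intros f g; simpl; [|rewrite IH]; lra. Qed.

Lemma gsum_const M q c : gsum M q (fun _ => c) = c * (1 - q ^ S M).
Proof. induction M as [|M IH]; simpl in *; [|rewrite IH]; ring. Qed.

Lemma gsum_const_le M q c : 0 <= q <= 1 -> 0 <= c -> gsum M q (fun _ => c) <= c.
Proof.
  intros Hq Hc; rewrite gsum_const. assert (0 <= q ^ S M) by (apply pow_le; lra). nra.
Qed.

Lemma gsum_nonneg M q f : 0 <= q <= 1 -> (forall a, 0 <= f a) -> 0 <= gsum M q f.
Proof.
  intros Hq H. replace 0 with (gsum M q (fun _ => 0)) by (rewrite gsum_const; ring).
  now apply gsum_le.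
Qed.

Lemma gsum_head M q f : 0 <= q <= 1 -> (forall a, 0 <= f a) -> (1 - q) * f O <= gsum M q f.
Proof.
  intros Hq H; destruct M as [|M]; simpl; [lra|].
  assert (0 <= gsum M q (fun a => f (S a))) by (apply gsum_nonneg; auto). nra.
Qed.

Lemma gsum_box_le M M' q f :
  0 <= q <= 1 -> (forall a, 0 <= f a) -> (M <= M')%nat -> gsum M q f <= gsum M' q f.
Proof.
  intros Hq; revert M' f; induction M as [|M IH]; intros M' f H HM.
  - now apply gsum_head.
  - destruct M' as [|M']; [lia|]. simpl. apply Rplus_le_compat_l.
    apply Rmult_le_compat_l; [lra|]. apply IH; auto; lia.
Qed.

Lemma gsum_box_eq M M' q f :
  (forall a, (M < a)%nat -> f a = 0) -> (M <= M')%nat -> gsum M' q f = gsum M q f.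
Proof.
  revert M' f; induction M as [|M IH]; intros M' f H HM.
  - destruct M' as [|M']; [reflexivity|]; simpl.
    rewrite (gsum_ext _ _ _ (fun _ => 0)) by (intros; apply H; lia).
    rewrite gsum_const; ring.
  - destruct M' as [|M']; [lia|]; simpl. f_equal. f_equal. apply IH; [|lia].
    intros; apply H; lia.
Qed.

Lemma gsum_antitone_le M q f :
  0 <= q <= 1 -> (forall a, f (S a) <= f a) -> (forall a, 0 <= f a) ->
  gsum M q f <= f O * (1 - q ^ S M).
Proof.
  intros Hq Hf H0. rewrite <- gsum_const. apply gsum_le; auto.
  induction a as [|a IH]; [lra|]. specialize (Hf a); lra.
Qed.

(** Raising the ratio shifts mass from the head [f 0] to the tail, whose truncated mean is at most
    [f 1 <= f 0]; inside the tail the induction hypothesis applies. *)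
Lemma gsum_antitone_param M q q' f :
  0 <= q <= q' -> q' <= 1 -> (forall a, f (S a) <= f a) -> (forall a, 0 <= f a) ->
  gsum M q' f <= gsum M q f.
Proof.
  intros Hq Hq'; revert f; induction M as [|M IH]; intros f Hf H0; simpl.
  - specialize (H0 O); nra.
  - assert (H1 := IH (fun a => f (S a)) (fun a => Hf (S a)) (fun a => H0 (S a))).
    assert (H2 := gsum_antitone_le M q (fun a => f (S a)) ltac:(lra)
                    (fun a => Hf (S a)) (fun a => H0 (S a))).
    cbv beta in H2.
    assert (0 <= q ^ S M) by (apply pow_le; lra).
    assert (f 1%nat <= f O) by auto. assert (0 <= f 1%nat) by auto.
    assert (gsum M q (fun a => f (S a)) <= f O) by nra.
    nra.
Qed.

(** Strictness holds even for constant [f], because the box misses the mass [q ^ S M > 0]: the tail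
    mean stays strictly below [f 0]. *)
Lemma gsum_antitone_param_lt M q q' f :
  0 < q < q' -> q' <= 1 -> (forall a, f (S a) <= f a) -> (forall a, 0 <= f a) -> 0 < f O ->
  gsum M q' f < gsum M q f.
Proof.
  intros Hq Hq' Hf H0 Hpos. destruct M as [|M]; simpl; [nra|].
  assert (H1 := gsum_antitone_param M q q' (fun a => f (S a)) ltac:(lra) Hq'
                  (fun a => Hf (S a)) (fun a => H0 (S a))).
  assert (H2 := gsum_antitone_le M q (fun a => f (S a)) ltac:(lra)
                  (fun a => Hf (S a)) (fun a => H0 (S a))).
  cbv beta in H2.
  assert (0 < q ^ S M) by (apply pow_lt; lra).
  assert (f 1%nat <= f O) by auto. assert (0 <= f 1%nat) by auto.
  assert (gsum M q (fun a => f (S a)) < f O).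
  { destruct (Req_dec (f 1%nat) 0) as [E|E]; [rewrite E in H2; lra|]. nra. }
  nra.
Qed.

(* If [X] is geometric with ratio [s] then [X / 2] (integer division) is geometric with ratio
   [s ^ 2]. *)
Lemma gsum_half M s f g :
  0 <= s <= 1 -> (forall a, f (2 * a)%nat <= g a) -> (forall a, f (2 * a + 1)%nat <= g a) ->
  gsum (2 * M + 1) s f <= gsum M (s * s) g.
Proof.
  intros Hs; revert f g; induction M as [|M IH]; intros f g H0 H1.
  - simpl. specialize (H0 O); specialize (H1 O); simpl in *.
    assert (f O * (1 - s) <= g O * (1 - s)) by nra.
    assert (s * (1 - s) * f 1%nat <= s * (1 - s) * g O) by (apply Rmult_le_compat_l; nra). nra.
  - replace (2 * S M + 1)%nat with (S (S (2 * M + 1))) by lia. simpl gsum at 1.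
    simpl gsum at 2.
    assert (IH' := IH (fun a => f (S (S a))) (fun a => g (S a))).
    assert (H2 : gsum (2 * M + 1) s (fun a => f (S (S a))) <=
                 gsum M (s * s) (fun a => g (S a))).
    { apply IH'; intros a; [specialize (H0 (S a))|specialize (H1 (S a))].
      - replace (2 * S a)%nat with (S (S (2 * a))) in H0 by lia; auto.
      - replace (2 * S a + 1)%nat with (S (S (2 * a + 1))) in H1 by lia; auto. }
    specialize (H0 O); specialize (H1 O); simpl (2 * 0)%nat in *; simpl (0 + 1)%nat in *.
    replace (M + (M + 0) + 1)%nat with (2 * M + 1)%nat by lia.
    assert (f O * (1 - s) <= g O * (1 - s)) by nra.
    assert (s * (1 - s) * f 1%nat <= s * (1 - s) * g O) by (apply Rmult_le_compat_l; nra).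
    assert (s * s * gsum (2 * M + 1) s (fun a => f (S (S a))) <=
            s * s * gsum M (s * s) (fun a => g (S a))) by (apply Rmult_le_compat_l; nra).
    nra.
Qed.

Lemma gsum_id_le M q : 0 <= q < 1 -> gsum M q INR <= q / (1 - q).
Proof.
  intros Hq.
  assert (Hl : 0 <= q / (1 - q)) by (apply Rle_mult_inv_pos; lra).
  (* The tail of [c + a] is [(c + 1) + a], so the induction needs a free constant; the bound is the
     solution of [e = q * (e + 1)]. *)
  assert (H : forall c, 0 <= c -> gsum M q (fun a => c + INR a) <= q / (1 - q) + c).
  { induction M as [|M IH]; intros c Hc; cbn [gsum].
    - simpl INR; nra.
    - rewrite (gsum_ext _ _ _ (fun a => (c + 1) + INR a)) by (intros; rewrite S_INR; ring).
      assert (IH' := IH (c + 1) ltac:(lra)). simpl INR.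
      assert (q / (1 - q) = q * (q / (1 - q) + 1)) by (field; lra). nra. }
  specialize (H 0 (Rle_refl 0)).
  rewrite (gsum_ext _ _ _ INR) in H by (intros; ring). lra.
Qed.

Lemma gsum_div2_le M q :
  0 <= q < 1 -> gsum M q (fun a => INR (a / 2)) <= q ^ 2 / (1 - q ^ 2).
Proof.
  intros Hq.
  assert (Hq2 : 0 <= q ^ 2 < 1) by (simpl; nra).
  assert (Hl : 0 <= q ^ 2 / (1 - q ^ 2)) by (apply Rle_mult_inv_pos; lra).
  assert (H : forall m, (m <= M)%nat -> forall c, 0 <= c ->
              gsum m q (fun a => c + INR (a / 2)) <= q ^ 2 / (1 - q ^ 2) + c).
  (* It takes two unfoldings of [gsum] to raise [a / 2] by one; the fixed point is now that of
     [e = q ^ 2 * (e + 1)]. *)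
  { induction M as [M IH] using lt_wf_ind; intros m Hm c Hc.
    destruct m as [|[|m]]; cbn [gsum];
      change (0 / 2)%nat with O; change (1 / 2)%nat with O; change (INR 0) with 0.
    - nra.
    - assert (q * ((1 - q) * (c + 0)) <= q * c) by (apply Rmult_le_compat_l; nra). nra.
    - rewrite (gsum_ext _ _ _ (fun a => (c + 1) + INR (a / 2))).
      2:{ intros a. replace (S (S a)) with (a + 1 * 2)%nat by lia.
          rewrite Nat.div_add by lia. rewrite plus_INR; simpl; ring. }
      assert (IH' := IH m ltac:(lia) m ltac:(lia) (c + 1) ltac:(lra)).
      assert (q ^ 2 / (1 - q ^ 2) = q ^ 2 * (q ^ 2 / (1 - q ^ 2) + 1)) by (field; lra).
      set (e := q ^ 2 / (1 - q ^ 2)) in *.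
      set (g := gsum m q (fun a => c + 1 + INR (a / 2))) in *.
      assert (q ^ 2 * g <= q ^ 2 * (e + (c + 1))) by (apply Rmult_le_compat_l; lra).
      nra. }
  specialize (H M (le_n _) 0 (Rle_refl 0)).
  rewrite (gsum_ext _ _ _ (fun a => INR (a / 2))) in H by (intros; ring). lra.
Qed.

Lemma gsum_le_indicator M q a :
  (a <= M)%nat -> gsum M q (fun b => if (b <=? a)%nat then 1 else 0) = 1 - q ^ S a.
Proof.
  intros HM.
  rewrite (gsum_box_eq a M) by (auto; intros b Hb; rewrite (proj2 (Nat.leb_gt _ _)); auto).
  assert (H : forall m f, (forall b, (b <= m)%nat -> f b = 1) -> gsum m q f = 1 - q ^ S m).
  { induction m as [|m IH]; intros f Hf; cbn [gsum].
    - rewrite Hf by lia; simpl; ring.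
    - rewrite IH by (intros; apply Hf; lia). rewrite Hf by lia. simpl; ring. }
  apply H. intros b Hb. rewrite (proj2 (Nat.leb_le _ _)); auto.
Qed.

(** * Independent geometric pebbles on several vertices *)

Definition upd (f : distribution) (k a : nat) : distribution :=
  fun i => if Nat.eqb i k then a else f i.

Lemma upd_eq f k a : upd f k a k = a.
Proof. unfold upd; now rewrite Nat.eqb_refl. Qed.

Lemma upd_neq f k a i : i <> k -> upd f k a i = f i.
Proof. intros H; unfold upd; now rewrite (proj2 (Nat.eqb_neq _ _)). Qed.

(** Expectation of [F] over independent geometric pebbles of ratio [q] on the vertices below [k],
    restricted to at most [M] pebbles on each; all other vertices are empty. The total mass is
    [(1 - q ^ S M) ^ k], not 1, so many facts about it are inequalities. *)
Fixpoint EM (k M : nat) (q : R) (F : distribution -> R) : R :=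
  match k with
  | O => F (fun _ => O)
  | S k' => EM k' M q (fun f => gsum M q (fun a => F (upd f k' a)))
  end.

Lemma EM_le k M q F G : 0 <= q <= 1 -> (forall d, F d <= G d) -> EM k M q F <= EM k M q G.
Proof.
  intros Hq; revert F G; induction k as [|k IH]; intros F G H; simpl; auto.
  apply IH; intros f; apply gsum_le; auto.
Qed.

Lemma EM_ext k M q F G : (forall d, F d = G d) -> EM k M q F = EM k M q G.
Proof. intros H; f_equal; extensionality d; auto. Qed.

Lemma EM_plus k M q F G : EM k M q (fun d => F d + G d) = EM k M q F + EM k M q G.
Proof.
  revert F G; induction k as [|k IH]; intros F G; simpl; auto.
  rewrite <- IH; apply EM_ext; intros f; apply gsum_plus.
Qed.

Lemma EM_scal k M q c F : EM k M q (fun d => c * F d) = c * EM k M q F.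
Proof.
  revert F; induction k as [|k IH]; intros F; simpl; auto.
  rewrite <- IH; apply EM_ext; intros f; apply gsum_scal.
Qed.

Lemma EM_const k M q c : EM k M q (fun _ => c) = c * (1 - q ^ S M) ^ k.
Proof.
  revert c; induction k as [|k IH]; intros c; simpl EM; [simpl; ring|].
  rewrite (EM_ext _ _ _ _ (fun _ => c * (1 - q ^ S M))) by (intros; apply gsum_const).
  rewrite IH; simpl; ring.
Qed.

Lemma mass_bounds M q : 0 <= q <= 1 -> 0 <= 1 - q ^ S M <= 1.
Proof.
  intros Hq. assert (0 <= q ^ S M) by (apply pow_le; lra).
  assert (q ^ S M <= 1 ^ S M) by (apply pow_incr; lra). rewrite pow1 in *; lra.
Qed.

Lemma EM_const_le k M q c : 0 <= q <= 1 -> 0 <= c -> EM k M q (fun _ => c) <= c.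
Proof.
  intros Hq Hc; rewrite EM_const. assert (H := mass_bounds M q Hq).
  assert ((1 - q ^ S M) ^ k <= 1 ^ k) by (apply pow_incr; lra).
  rewrite pow1 in *. nra.
Qed.

Lemma EM_nonneg k M q F : 0 <= q <= 1 -> (forall d, 0 <= F d) -> 0 <= EM k M q F.
Proof.
  intros Hq H. replace 0 with (EM k M q (fun _ => 0)) by (rewrite EM_const; ring).
  now apply EM_le.
Qed.

Lemma EM_box_le k M M' q F :
  0 <= q <= 1 -> (forall d, 0 <= F d) -> (M <= M')%nat -> EM k M q F <= EM k M' q F.
Proof.
  intros Hq H HM; revert F H; induction k as [|k IH]; intros F H; simpl; [lra|].
  apply Rle_trans with (EM k M q (fun f => gsum M' q (fun a => F (upd f k a)))).
  - apply EM_le; auto; intros f; apply gsum_box_le; auto.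
  - apply IH; intros f; apply gsum_nonneg; auto.
Qed.

Lemma EM_box_eq k M M' q F :
  (forall d i, (i < k)%nat -> (M < d i)%nat -> F d = 0) -> (M <= M')%nat ->
  EM k M' q F = EM k M q F.
Proof.
  intros H HM; revert F H; induction k as [|k IH]; intros F H; simpl; [reflexivity|].
  rewrite IH.
  - apply EM_ext; intros f; apply gsum_box_eq; auto.
    intros a Ha; apply (H _ k); [lia|]. now rewrite upd_eq.
  - intros d i Hi Hd. rewrite (gsum_ext _ _ _ (fun _ => 0)).
    + rewrite gsum_const; ring.
    + intros a; apply (H _ i); [lia|]. rewrite upd_neq by lia; auto.
Qed.

Definition antitone (F : distribution -> R) : Prop :=
  forall d d', (forall i, (d i <= d' i)%nat) -> F d' <= F d.

Lemma antitone_gsum M q k F :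
  0 <= q <= 1 -> antitone F -> antitone (fun f => gsum M q (fun a => F (upd f k a))).
Proof.
  intros Hq HF d d' H. apply gsum_le; auto. intros a; apply HF; intros i.
  unfold upd; destruct (Nat.eqb i k); auto.
Qed.

Lemma antitone_upd k f F : antitone F -> forall a, F (upd f k (S a)) <= F (upd f k a).
Proof.
  intros HF a; apply HF; intros i; unfold upd; destruct (Nat.eqb i k); auto.
Qed.

(** The ratio is changed one vertex at a time: weakly at the last vertex, strictly at the others by
    induction. Positivity at the empty distribution survives the integration, since the term without
    pebbles alone contributes a positive amount. *)
Lemma EM_antitone_param k M q q' F :
  (0 < k)%nat -> 0 < q < q' -> q' < 1 -> antitone F -> (forall d, 0 <= F d) ->
  0 < F (fun _ => O) -> EM k M q' F < EM k M q F.
Proof.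
  intros Hk Hq Hq' HF H0 Hpos.
  assert (E : forall j, upd (fun _ => O) j O = fun _ => O).
  { intros j; extensionality i; unfold upd; now destruct (Nat.eqb i j). }
  revert F HF H0 Hpos; induction k as [|k IH]; intros F HF H0 Hpos; [lia|].
  destruct k as [|k].
  - simpl. apply gsum_antitone_param_lt; auto; try lra.
    + now apply antitone_upd.
    + now rewrite E.
  - change (EM (S k) M q' (fun f => gsum M q' (fun a => F (upd f (S k) a))) <
            EM (S k) M q (fun f => gsum M q (fun a => F (upd f (S k) a)))).
    apply Rle_lt_trans with (EM (S k) M q' (fun f => gsum M q (fun a => F (upd f (S k) a)))).
    + apply EM_le; [lra|]; intros f. apply gsum_antitone_param; auto; try lra.
      now apply antitone_upd.
    + apply IH; [lia|apply antitone_gsum; auto; lra| |].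
      * intros f; apply gsum_nonneg; auto; lra.
      * apply Rlt_le_trans with ((1 - q) * F (upd (fun _ => O) (S k) O)).
        -- rewrite E; apply Rmult_lt_0_compat; lra.
        -- apply (gsum_head M q (fun a => F (upd (fun _ => O) (S k) a))); auto; lra.
Qed.

(** [gsum_half] at every vertex. The hypothesis compares all pairs with [2 * d <= d'] rather than
    [d' = 2 * d], so that it covers both parities and survives the integration of one vertex. *)
Lemma EM_half k M s F G :
  0 <= s <= 1 ->
  (forall d d', (forall i, (2 * d i <= d' i)%nat) -> F d' <= G d) ->
  EM k (2 * M + 1) s F <= EM k M (s * s) G.
Proof.
  intros Hs; revert F G; induction k as [|k IH]; intros F G H; simpl EM.
  - apply H; intros; lia.
  - apply IH. intros d d' Hd. apply gsum_half; auto; intros a; apply H;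
      intros i; unfold upd; destruct (Nat.eqb i k); auto; lia.
Qed.

Lemma EM_prod k M q g : EM k M q (fun d => rprod k (fun i => g i (d i))) =
  rprod k (fun i => gsum M q (g i)).
Proof.
  assert (H : forall c, EM k M q (fun d => c * rprod k (fun i => g i (d i))) =
    c * rprod k (fun i => gsum M q (g i))).
  { induction k as [|k IH]; intros c; simpl; auto.
    rewrite (EM_ext _ _ _ _ (fun f => (c * gsum M q (g k)) * rprod k (fun i => g i (f i)))).
    - rewrite IH; ring.
    - intros f.
      rewrite (gsum_ext _ _ _ (fun a => (c * rprod k (fun i => g i (f i))) * g k a)).
      + rewrite gsum_scal; ring.
      + intros a. rewrite upd_eq.
        rewrite (rprod_ext k _ (fun i => g i (f i)));
          [ring | intros i Hi; now rewrite upd_neq by lia]. }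
  specialize (H 1). rewrite Rmult_1_l in H. rewrite <- H.
  apply EM_ext; intros; ring.
Qed.

(** Linearity of expectation; only an upper bound because each summand is also multiplied by the
    mass, at most one, of the remaining vertices. *)
Lemma EM_sum_le k M q g e :
  0 <= q <= 1 -> (forall i a, (i < k)%nat -> 0 <= g i a) ->
  (forall i, (i < k)%nat -> gsum M q (g i) <= e i) ->
  EM k M q (fun d => rsum k (fun i => g i (d i))) <= rsum k e.
Proof.
  intros Hq H0 He.
  assert (H : forall c, 0 <= c ->
    EM k M q (fun d => c + rsum k (fun i => g i (d i))) <= c + rsum k e).
  { induction k as [|k IH]; intros c Hc; simpl; [lra|].
    apply Rle_trans with (EM k M q (fun f => (c + e k) + rsum k (fun i => g i (f i)))).
    - apply EM_le; auto; intros f.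
      rewrite (gsum_ext _ _ _ (fun a => (c + rsum k (fun i => g i (f i))) + g k a)).
      + rewrite gsum_plus.
        assert (0 <= rsum k (fun i => g i (f i))) by (apply rsum_nonneg; auto).
        assert (gsum M q (fun _ => c + rsum k (fun i => g i (f i))) <=
                c + rsum k (fun i => g i (f i))) by (apply gsum_const_le; auto; lra).
        assert (Hk : gsum M q (g k) <= e k) by (apply He; lia). lra.
      + intros a. rewrite upd_eq.
        rewrite (rsum_ext k _ (fun i => g i (f i)));
          [ring | intros i Hi; now rewrite upd_neq by lia].
    - assert (0 <= e k).
      { apply Rle_trans with (gsum M q (g k)); [|apply He; lia].
        apply gsum_nonneg; auto. }
      rewrite <- (Rplus_comm (e k)), <- Rplus_assoc.
      rewrite (Rplus_comm (e k) c). apply Rle_trans with ((c + e k) + rsum k e); [|lra].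
      apply IH; auto; lra. }
  specialize (H 0 (Rle_refl 0)). rewrite Rplus_0_l in H.
  eapply Rle_trans; [|exact H]. apply EM_le; auto; intros; lra.
Qed.

(** Independence of two disjoint blocks of vertices, the second one reindexed from 0. *)
Lemma EM_block k L M q A B :
  (forall f g, (forall i, (i < k)%nat -> f i = g i) -> A f = A g) ->
  (forall f g, (forall i, (i < L)%nat -> f i = g i) -> B f = B g) ->
  EM (k + L) M q (fun d => A d * B (fun i => d (k + i)%nat)) = EM k M q A * EM L M q B.
Proof.
  intros HA; revert B; induction L as [|L IH]; intros B HB.
  - rewrite Nat.add_0_r. simpl (EM 0).
    rewrite (EM_ext _ _ _ _ (fun d => B (fun _ => O) * A d)).
    + rewrite EM_scal; ring.
    + intros d. rewrite (HB _ (fun _ => O)) by (intros; lia). ring.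
  - rewrite Nat.add_succ_r; simpl. rewrite <- IH.
    + apply EM_ext; intros f. rewrite <- gsum_scal. apply gsum_ext; intros a.
      f_equal; [apply HA; intros; apply upd_neq; lia|].
      apply HB; intros i Hi; unfold upd.
      destruct (Nat.eqb_spec (k + i) (k + L)), (Nat.eqb_spec i L); auto; lia.
    + intros f g H. apply gsum_ext; intros a. apply HB; intros i Hi.
      unfold upd; destruct (Nat.eqb_spec i L); auto. apply H; lia.
Qed.

Lemma EM_extend_le k L M q F :
  0 <= q <= 1 -> (forall f g, (forall i, (i < k)%nat -> f i = g i) -> F f = F g) ->
  (forall d, 0 <= F d) -> EM (k + L) M q F <= EM k M q F.
Proof.
  intros Hq HF H0.
  rewrite (EM_ext _ _ _ F (fun d => F d * (fun _ => 1) (fun i => d (k + i)%nat)))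
    by (intros; symmetry; apply Rmult_1_r).
  rewrite (EM_block k L M q F (fun _ => 1)); auto.
  rewrite <- (Rmult_1_r (EM k M q F)) at 2.
  apply Rmult_le_compat_l; [apply EM_nonneg; auto | apply EM_const_le; lra].
Qed.

Lemma continuity_gsum M (g : R -> nat -> R) :
  (forall a, continuity (fun q => g q a)) -> continuity (fun q => gsum M q (g q)).
Proof.
  assert (H1 : continuity (fun q => 1 - q)).
  { apply (continuity_minus (fun _ => 1) (fun q => q)).
    - apply continuity_const; intros x y; reflexivity.
    - apply derivable_continuous, derivable_id. }
  revert g; induction M as [|M IH]; intros g H; simpl.
  - now apply (continuity_mult (fun q => 1 - q) (fun q => g q O)).
  - apply (continuity_plus (fun q => (1 - q) * g q O)
             (fun q => q * gsum M q (fun a => g q (S a)))).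
    + now apply (continuity_mult (fun q => 1 - q) (fun q => g q O)).
    + apply (continuity_mult (fun q => q) (fun q => gsum M q (fun a => g q (S a)))).
      * apply derivable_continuous, derivable_id.
      * apply (IH (fun q a => g q (S a))); auto.
Qed.

Lemma continuity_EM k M (F : R -> distribution -> R) :
  (forall d, continuity (fun q => F q d)) -> continuity (fun q => EM k M q (F q)).
Proof.
  revert F; induction k as [|k IH]; intros F H; simpl; auto.
  apply (IH (fun q f => gsum M q (fun a => F q (upd f k a)))).
  intros d. apply (continuity_gsum M (fun q a => F q (upd d k a))). auto.
Qed.

(** The bridge from the enumerated sums in the definition of the threshold to the recursive
    expectation, on which all later arguments work. *)
Lemma EM_box_dists k M p F :
  fold_right Rplus 0 (map (fun d => geom_weight k p d * F d) (box_dists k M)) =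
  EM k M (1 - p) F.
Proof.
  assert (Happ : forall l l', fold_right Rplus 0 (l ++ l') =
                   fold_right Rplus 0 l + fold_right Rplus 0 l').
  { induction l as [|x l IHl]; intros l'; simpl; [lra|]. rewrite IHl; lra. }
  assert (Hw : forall j i f a, (j <= i)%nat -> geom_weight j p (upd f i a) = geom_weight j p f).
  { induction j as [|j IHj]; intros i f a Hj; simpl; auto.
    rewrite IHj, upd_neq by lia; auto. }
  assert (Hs : forall g b m, fold_right Rplus 0
             (map (fun a => p * (1 - p) ^ a * g a) (seq b (S m))) =
             (1 - p) ^ b * gsum m (1 - p) (fun a => g (b + a)%nat)).
  { intros g b m; revert b; induction m as [|m IHm]; intros b.
    - simpl. rewrite Nat.add_0_r. ring.
    - change (seq b (S (S m))) with (b :: seq (S b) (S m)).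
      rewrite map_cons. simpl fold_right.
      change (map (fun a => p * (1 - p) ^ a * g a) (S b :: seq (S (S b)) m)) with
        (map (fun a => p * (1 - p) ^ a * g a) (seq (S b) (S m))).
      change (p * (1 - p) ^ b * g b +
        fold_right Rplus 0 (map (fun a => p * (1 - p) ^ a * g a) (seq (S b) (S m))) =
        (1 - p) ^ b * gsum (S m) (1 - p) (fun a => g (b + a)%nat)).
      rewrite IHm. cbn [gsum]. rewrite Nat.add_0_r.
      rewrite (gsum_ext m (1 - p) (fun a => g (S b + a)%nat) (fun a => g (b + S a)%nat))
        by (intros; f_equal; lia).
      simpl pow. ring. }
  revert F; induction k as [|k IH]; intros F.
  - simpl; ring.
  - change (EM (S k) M (1 - p) F) with
      (EM k M (1 - p) (fun f => gsum M (1 - p) (fun a => F (upd f k a)))).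
    rewrite <- IH.
    change (box_dists (S k) M) with
      (flat_map (fun f => map (fun a => upd f k a) (seq 0 (S M))) (box_dists k M)).
    clear IH. induction (box_dists k M) as [|f l IHl]; [reflexivity|].
    cbn [flat_map]. rewrite map_app, Happ, IHl. cbn [map fold_right]. f_equal.
    rewrite map_map.
    rewrite (map_ext _ (fun a => p * (1 - p) ^ a * (geom_weight k p f * F (upd f k a)))).
    + rewrite (Hs (fun a => geom_weight k p f * F (upd f k a))).
      rewrite gsum_scal. cbn [pow plus]. rewrite Rmult_1_l. reflexivity.
    + intros a. simpl geom_weight. rewrite Hw, upd_eq by lia. ring.
Qed.

(** * Pebbling *)

(* [reach E d r]: a pebble can be brought to [r] from [d], witnessed by the binary tree of the
   moves producing it, whose leaves are initial pebbles. *)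
Inductive reach (E : nat -> nat -> Prop) : distribution -> nat -> Prop :=
| reach_leaf d r : (1 <= d r)%nat -> reach E d r
| reach_node d d1 d2 u r :
    (forall w, (d1 w + d2 w <= d w)%nat) -> E u r ->
    reach E d1 u -> reach E d2 u -> reach E d r.

Lemma reach_mono E d d' r : (forall w, (d w <= d' w)%nat) -> reach E d r -> reach E d' r.
Proof.
  intros H Hr. revert d' H; induction Hr as [d r Hd|d d1 d2 u r Hs He H1 _ H2 _]; intros d' H.
  - apply reach_leaf. specialize (H r); lia.
  - apply (reach_node E d' d1 d2 u); auto. intros w; specialize (H w); specialize (Hs w); lia.
Qed.

(** Undoing a move: the pebble that it put on [v] is a leaf of the tree, and that leaf is replaced
    by a node over two leaves at [u]. At an inner node the replacement is passed to a subtree that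
    has a pebble on [v] in its share. *)
Lemma reach_unmove E d u v r :
  E u v -> reach E d r ->
  reach E (fun w => (d w - (if Nat.eqb w v then 1 else 0)) + (if Nat.eqb w u then 2 else 0))%nat r.
Proof.
  intros He Hr; induction Hr as [d r Hd|d d1 d2 x r Hs Hx H1 IH1 H2 IH2].
  - destruct (Nat.eq_dec r v) as [->|Hne].
    + apply (reach_node E _ (fun w => if Nat.eqb w u then 1 else 0)%nat
                          (fun w => if Nat.eqb w u then 1 else 0)%nat u); auto.
      * intros w; destruct (Nat.eqb w u); lia.
      * apply reach_leaf; rewrite Nat.eqb_refl; lia.
      * apply reach_leaf; rewrite Nat.eqb_refl; lia.
    + apply reach_leaf. rewrite (proj2 (Nat.eqb_neq r v)) by auto. lia.
  - destruct (le_lt_dec 1 (d1 v)) as [Hv|Hv].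
    + refine (reach_node E _ _ _ x r _ Hx IH1 H2).
      intros w; specialize (Hs w); cbv beta.
      destruct (Nat.eqb_spec w v), (Nat.eqb_spec w u); subst; lia.
    + refine (reach_node E _ _ _ x r _ Hx H1 IH2).
      intros w; specialize (Hs w); cbv beta.
      destruct (Nat.eqb_spec w v), (Nat.eqb_spec w u); subst; lia.
Qed.

Notation steps n adj := (clos_refl_trans distribution (pebbling_move n adj)).

Lemma pebblable_reach n adj d r :
  simple_graph n adj -> pebblable n adj d r -> reach (edge_in n adj) d r.
Proof.
  intros Hg [d' [Hst Hr]]. apply clos_rt_rt1n in Hst.
  induction Hst as [d|d d1 d2 Hm Hst IH]; [now apply reach_leaf|].
  specialize (IH Hr). destruct Hm as [u [v [He [Hu ->]]]].
  refine (reach_mono _ _ _ _ _ (reach_unmove _ _ u v r He IH)).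
  assert (u <> v).
  { intros <-. destruct He as [H1 [_ H2]]. destruct (Hg u u H1 H1); congruence. }
  intros w; cbv beta. destruct (Nat.eqb_spec w u), (Nat.eqb_spec w v); subst; lia.
Qed.

Lemma steps_frame n adj d d' e :
  steps n adj d d' -> steps n adj (fun w => d w + e w)%nat (fun w => d' w + e w)%nat.
Proof.
  intros H; induction H as [d d' [u [v [He [Hu ->]]]]|d|d d1 d2 _ IH1 _ IH2].
  - apply rt_step. exists u, v; repeat split; try apply He; [lia|].
    extensionality w. destruct (Nat.eqb_spec w u), (Nat.eqb_spec w v); subst; lia.
  - apply rt_refl.
  - now apply rt_trans with (fun w => d1 w + e w)%nat.
Qed.

Lemma reach_pebblable n adj d r : reach (edge_in n adj) d r -> pebblable n adj d r.
Proof.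
  intros H; induction H as [d r Hd|d d1 d2 u r Hs He _ [e1 [S1 P1]] _ [e2 [S2 P2]]].
  - exists d; split; [apply rt_refl|auto].
  - assert (St : steps n adj d (fun w => e1 w + (e2 w + (d w - d1 w - d2 w)))%nat).
    { apply rt_trans with (fun w => d1 w + (e2 w + (d w - d1 w - d2 w)))%nat.
      (* The moves of the second subtree are played first, then those of the first, each with all
         remaining pebbles standing idle. *)
      - replace d with (fun w => d2 w + (d1 w + (d w - d1 w - d2 w)))%nat at 1
          by (extensionality w; specialize (Hs w); lia).
        replace (fun w => d1 w + (e2 w + (d w - d1 w - d2 w)))%nat with
          (fun w => e2 w + (d1 w + (d w - d1 w - d2 w)))%nat by (extensionality w; lia).
        now apply steps_frame.
      - now apply steps_frame. }
    set (e := (fun w => e1 w + (e2 w + (d w - d1 w - d2 w)))%nat) in St.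
    assert (Hu : (2 <= e u)%nat) by (unfold e; lia).
    (* The graph is not assumed simple here, so the edge may be a loop; the pebbles are then already
       on the target. *)
    destruct (Nat.eq_dec r u) as [->|Hne].
    + exists e; split; [exact St|lia].
    + eexists; split;
        [eapply rt_trans;
         [exact St
         |apply rt_step; exists u, r; split; [exact He|split; [exact Hu|reflexivity]]]|].
      cbv beta; rewrite (proj2 (Nat.eqb_neq r u)), Nat.eqb_refl by auto. lia.
Qed.

Lemma solvable_mono n adj d d' :
  simple_graph n adj -> (forall w, (d w <= d' w)%nat) ->
  solvable n adj d -> solvable n adj d'.
Proof.
  intros Hg H Hs r Hr. apply reach_pebblable.
  apply (reach_mono _ d); auto. apply pebblable_reach; auto.
Qed.

(** * Adding an edge between two vertices at distance two *)

Definition add_edge (u v : nat) (adj : nat -> nat -> bool) (a b : nat) : bool :=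
  adj a b || (Nat.eqb a u && Nat.eqb b v) || (Nat.eqb a v && Nat.eqb b u).

(* Trees in which every branch uses the additional edge [u v] at most once. *)
Inductive reach_once (E : nat -> nat -> Prop) (u v : nat) : distribution -> nat -> Prop :=
| once_base d r : reach E d r -> reach_once E u v d r
| once_edge d d1 d2 a b :
    (forall w, (d1 w + d2 w <= d w)%nat) -> (a = u /\ b = v) \/ (a = v /\ b = u) ->
    reach E d1 a -> reach E d2 a -> reach_once E u v d b
| once_node d d1 d2 x r :
    (forall w, (d1 w + d2 w <= d w)%nat) -> E x r ->
    reach_once E u v d1 x -> reach_once E u v d2 x -> reach_once E u v d r.

Lemma reach_once_mono E u v d d' r :
  (forall w, (d w <= d' w)%nat) -> reach_once E u v d r -> reach_once E u v d' r.
Proof.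
  intros H Hr. revert d' H.
  induction Hr as [d r Hd|d d1 d2 a b Hs Hab Ha Hb|d d1 d2 x r Hs He H1 _ H2 _]; intros d' H.
  - apply once_base. now apply (reach_mono E d).
  - apply (once_edge E u v d' d1 d2 a); auto. intros w; specialize (H w); specialize (Hs w); lia.
  - apply (once_node E u v d' d1 d2 x); auto. intros w; specialize (H w); specialize (Hs w); lia.
Qed.

(* A subtree using the edge contains subtrees rooted at both of its ends. *)
Lemma reach_once_cases E u v d r :
  reach_once E u v d r -> reach E d r \/ (reach_once E u v d u /\ reach_once E u v d v).
Proof.
  intros Hr.
  induction Hr as [d r Hd|d d1 d2 a b Hs Hab Ha Hb|d d1 d2 x r Hs He H1 IH1 H2 IH2]; auto.
  - right. assert (reach_once E u v d a).
    { apply once_base, (reach_mono E d1); auto. intros w; specialize (Hs w); lia. }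
    assert (reach_once E u v d b) by (eapply once_edge; eauto).
    destruct Hab as [[-> ->]|[-> ->]]; auto.
  - assert (forall w, (d1 w <= d w)%nat) by (intros w; specialize (Hs w); lia).
    assert (forall w, (d2 w <= d w)%nat) by (intros w; specialize (Hs w); lia).
    destruct IH1 as [R1|[A B]]; [|right; split; apply (reach_once_mono _ _ _ d1); auto].
    destruct IH2 as [R2|[A B]]; [|right; split; apply (reach_once_mono _ _ _ d2); auto].
    left; eapply reach_node; eauto.
Qed.

(** If a node crosses the new edge and one of its subtrees has crossed it before, that subtree
    already provides a tree for either end of the edge, in particular for [r]; it then replaces the
    whole node. *)
Lemma reach_add_edge_once n adj u v d r :
  reach (edge_in n (add_edge u v adj)) d r -> reach_once (edge_in n adj) u v d r.
Proof.
  intros Hr; induction Hr as [d r Hd|d d1 d2 x r Hs He H1 IH1 H2 IH2].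
  - now apply once_base, reach_leaf.
  - assert (forall w, (d1 w <= d w)%nat) by (intros w; specialize (Hs w); lia).
    assert (forall w, (d2 w <= d w)%nat) by (intros w; specialize (Hs w); lia).
    destruct He as [Hx [Hr Ha]].
    destruct (adj x r) eqn:E.
    { eapply once_node; eauto. repeat split; auto. }
    assert (Hxr : (x = u /\ r = v) \/ (x = v /\ r = u)).
    { unfold add_edge in Ha. rewrite E in Ha. simpl in Ha.
      apply Bool.orb_true_iff in Ha. destruct Ha as [Ha|Ha]; apply andb_prop in Ha;
        destruct Ha as [A B]; apply Nat.eqb_eq in A, B; auto. }
    destruct (reach_once_cases _ _ _ _ _ IH1) as [R1|[A B]].
    2:{ apply (reach_once_mono _ _ _ d1); auto. destruct Hxr as [[_ ->]|[_ ->]]; auto. }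
    destruct (reach_once_cases _ _ _ _ _ IH2) as [R2|[A B]].
    2:{ apply (reach_once_mono _ _ _ d2); auto. destruct Hxr as [[_ ->]|[_ ->]]; auto. }
    eapply once_edge; eauto.
Qed.

(* With twice as many pebbles the move along [u v] can be routed through the middle vertex [w]. *)
Lemma reach_once_double E u v w d r :
  E u w -> E w v -> E v w -> E w u ->
  reach_once E u v d r -> reach E (fun x => 2 * d x)%nat r.
Proof.
  intros Huw Hwv Hvw Hwu Hr.
  induction Hr as [d r Hd|d d1 d2 a b Hs Hab Ha Hb|d d1 d2 x r Hs He H1 IH1 H2 IH2].
  - apply (reach_mono E d); auto; intros; lia.
  - assert (R : E a w -> reach E (fun x => d1 x + d2 x)%nat w).
    { intros Haw. apply (reach_node E _ d1 d2 a); auto. }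
    apply (reach_node E _ (fun x => d1 x + d2 x)%nat (fun x => d1 x + d2 x)%nat w).
    + intros x; specialize (Hs x); lia.
    + destruct Hab as [[_ ->]|[_ ->]]; auto.
    + apply R. destruct Hab as [[-> _]|[-> _]]; auto.
    + apply R. destruct Hab as [[-> _]|[-> _]]; auto.
  - refine (reach_node E _ _ _ x r _ He IH1 IH2). intros y; specialize (Hs y); cbv beta; lia.
Qed.

Lemma edge_in_sym n adj a b : simple_graph n adj -> edge_in n adj a b -> edge_in n adj b a.
Proof.
  intros Hg [Ha [Hb H]]. destruct (Hg a b Ha Hb) as [E _]. repeat split; auto. congruence.
Qed.

Lemma add_edge_simple n adj u v :
  u <> v -> simple_graph n adj -> simple_graph n (add_edge u v adj).
Proof.
  intros Huv Hg a b Ha Hb. destruct (Hg a b Ha Hb) as [E1 E2]. unfold add_edge.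
  rewrite E1, E2. split.
  - destruct (adj b a); simpl; auto.
    destruct (Nat.eqb_spec a u), (Nat.eqb_spec b v), (Nat.eqb_spec a v), (Nat.eqb_spec b u);
      auto.
  - simpl. destruct (Nat.eqb_spec a u), (Nat.eqb_spec a v); auto; congruence.
Qed.

Lemma add_edge_connected n adj u v : connected n adj -> connected n (add_edge u v adj).
Proof.
  intros H a b Ha Hb. specialize (H a b Ha Hb).
  induction H as [a b [H1 [H2 H3]]|a|a b c _ IH1 Hbc IH2].
  - apply rt_step; repeat split; auto. unfold add_edge; now rewrite H3.
  - apply rt_refl.
  (* The closure lives on all of [nat], so the intermediate point need not be a vertex. Outside the
     range no edge starts, which forces [b = c] and contradicts [c < n]. *)
  - destruct (le_lt_dec n b) as [Hnb|Hnb].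
    + assert (b = c).
      { apply clos_rt_rt1n in Hbc. inversion Hbc as [|y z [Hy _]]; subst; auto. lia. }
      subst c; lia.
    + apply rt_trans with b; auto.
Qed.

Lemma solvable_add_edge n adj u v w d d' :
  simple_graph n adj -> u <> v ->
  edge_in n adj u w -> edge_in n adj w v ->
  (forall x, (2 * d x <= d' x)%nat) ->
  solvable n (add_edge u v adj) d -> solvable n adj d'.
Proof.
  intros Hg Huv Huw Hwv Hd Hs r Hr. apply reach_pebblable.
  apply (reach_mono _ (fun x => 2 * d x)%nat); auto.
  apply (reach_once_double _ u v w); auto; try (apply edge_in_sym; assumption).
  apply reach_add_edge_once, pebblable_reach; auto using add_edge_simple.
Qed.

(** Without such a triple, every vertex met on a walk from [u] would be [u] or a neighbour of [u],
    so [u] would be adjacent to [v]. *)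
Lemma exists_distance_two n adj :
  connected n adj -> (exists u v, (u < n)%nat /\ (v < n)%nat /\ u <> v /\ adj u v = false) ->
  exists u w v, u <> v /\ adj u v = false /\ edge_in n adj u w /\ edge_in n adj w v.
Proof.
  intros Hc [u [v [Hu [Hv [Huv Ha]]]]]. apply NNPP; intros Hno.
  specialize (Hc u v Hu Hv). apply clos_rt_rtn1 in Hc.
  assert (H : u = v \/ adj u v = true); [|destruct H; congruence].
  clear Ha Huv Hv. induction Hc as [|w v He Hc IH]; [auto|].
  destruct (Nat.eq_dec u v) as [|Hne]; auto. right.
  destruct IH as [<-|IH]; [apply He|].
  destruct (adj u v) eqn:E; auto. exfalso; apply Hno.
  exists u, w, v; split; [auto|split; [auto|split; [|auto]]].
  destruct He as [Hw _]. repeat split; auto.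
Qed.

(** * Moving pebbles along walks, and weights that no move increases *)

Lemma steps_push n adj u v k d :
  simple_graph n adj -> edge_in n adj u v -> (2 * k <= d u)%nat ->
  exists d', steps n adj d d' /\ (k <= d' v)%nat.
Proof.
  intros Hg He. revert d; induction k as [|k IH]; intros d Hk.
  - exists d; split; [apply rt_refl|lia].
  - assert (Huv : u <> v).
    { intros <-. destruct He as [H1 [_ H2]]. destruct (Hg u u H1 H1); congruence. }
    (* Counting what is left on [u] guarantees that a pair remains for the next move. *)
    assert (H : exists d', steps n adj d d' /\ (k <= d' v)%nat /\ (d' u = d u - 2 * k)%nat).
    2:{ destruct H as [d' [Hs [Hv Hu]]].
        eexists; split;
          [eapply rt_trans;
           [exact Hs
           |apply rt_step; exists u, v; split; [exact He|split; [lia|reflexivity]]]|].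
        cbv beta; rewrite (proj2 (Nat.eqb_neq v u)), Nat.eqb_refl by auto. lia. }
    clear IH. induction k as [|k IH].
    + exists d; repeat split; [apply rt_refl|lia|lia].
    + destruct IH as [d' [Hs [Hv Hu]]]; [lia|].
      eexists; split;
        [eapply rt_trans;
         [exact Hs
         |apply rt_step; exists u, v; split; [exact He|split; [lia|reflexivity]]]|].
      cbv beta; rewrite (proj2 (Nat.eqb_neq v u)), !Nat.eqb_refl by auto. lia.
Qed.

Inductive walk (n : nat) (adj : nat -> nat -> bool) : nat -> nat -> nat -> Prop :=
| walk_nil u : walk n adj 0 u u
| walk_cons k u v w : edge_in n adj u v -> walk n adj k v w -> walk n adj (S k) u w.

Lemma pebblable_walk n adj k u r d :
  simple_graph n adj -> walk n adj k u r -> (2 ^ k <= d u)%nat -> pebblable n adj d r.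
Proof.
  intros Hg Hw; revert d; induction Hw as [u|k u v w He Hw IH]; intros d Hd.
  - exists d; split; [apply rt_refl|auto].
  - destruct (steps_push n adj u v (2 ^ k) d) as [d1 [Hs Hv]]; auto.
    destruct (IH d1 Hv) as [d2 [Hs2 Hr]]. exists d2; split; auto.
    now apply rt_trans with d1.
Qed.

(** Only the existence of a uniform length matters: it makes any single vertex with enough pebbles
    solve the graph, so that insolvability is confined to a finite box. *)
Lemma connected_bounded_walks n adj :
  connected n adj -> exists D, forall u v, (u < n)%nat -> (v < n)%nat ->
    exists k, (k <= D)%nat /\ walk n adj k u v.
Proof.
  intros Hc.
  assert (Hw : forall u v, (u < n)%nat -> (v < n)%nat -> exists k, walk n adj k u v).
  { intros u v Hu Hv. specialize (Hc u v Hu Hv). apply clos_rt_rt1n in Hc.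
    induction Hc as [u|u w v He Hc IH]; [exists O; constructor|].
    destruct IH as [k Hk]; auto; [apply He|]. exists (S k); econstructor; eauto. }
  assert (Hb : forall (P : nat -> nat -> Prop) m,
    (forall v, (v < m)%nat -> exists k, forall k', (k <= k')%nat -> P v k') ->
    exists D, forall k', (D <= k')%nat -> forall v, (v < m)%nat -> P v k').
  { intros P m; induction m as [|m IH]; intros H; [exists O; intros; lia|].
    destruct IH as [D HD]; [intros; apply H; lia|].
    destruct (H m) as [k Hk]; [lia|]. exists (D + k)%nat; intros k' Hk' v Hv.
    destruct (Nat.eq_dec v m) as [->|]; [apply Hk|apply HD]; lia. }
  destruct (Hb (fun u D => forall v, (v < n)%nat -> exists k, (k <= D)%nat /\ walk n adj k u v) n)
    as [D HD].
  - intros u Hu.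
    destruct (Hb (fun v D => exists k, (k <= D)%nat /\ walk n adj k u v) n) as [D HD].
    + intros v Hv. destruct (Hw u v Hu Hv) as [k Hk]. exists k; intros; exists k; auto.
    + exists D; intros k' Hk' v Hv; apply HD; auto.
  - exists D; intros u v Hu Hv. apply (HD D); auto.
Qed.

(** The total weight never grows along moves, and at the end [r] holds a pebble. The weight may be
    nonlinear in the number of pebbles, so that some vertices can be charged by pairs. *)
Lemma potential_bound n adj (phi : nat -> nat -> R) d r :
  (r < n)%nat -> simple_graph n adj ->
  (forall v k, 0 <= phi v k) -> (forall k, phi r k <= phi r (S k)) ->
  (forall u v j k, edge_in n adj u v ->
     phi v (S j) + phi u k <= phi v j + phi u (S (S k))) ->
  pebblable n adj d r -> phi r 1%nat <= rsum n (fun v => phi v (d v)).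
Proof.
  intros Hr Hg H0 Hm Hphi [d' [Hs Hd]]. apply clos_rt_rt1n in Hs.
  induction Hs as [d|d d1 d2 Hmv Hs IH].
  - apply Rle_trans with (phi r (d r)).
    + induction Hd as [|k Hk IH]; [lra|]. specialize (Hm k); lra.
    + apply (rsum_ge_term n (fun v => phi v (d v))); auto.
  - apply Rle_trans with (rsum n (fun v => phi v (d1 v))); [auto|].
    destruct Hmv as [u [v [He [Hu ->]]]].
    assert (Huv : u <> v).
    { intros <-. destruct He as [H1 [_ H2]]. destruct (Hg u u H1 H1); congruence. }
    assert (Hsplit : forall m (f g : nat -> R) a b, a <> b -> (a < m)%nat -> (b < m)%nat ->
      (forall i, i <> a -> i <> b -> f i = g i) ->
      rsum m f - rsum m g = (f a - g a) + (f b - g b)).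
    { assert (H1 : forall m (f g : nat -> R) a, (a < m)%nat ->
        (forall i, (i < m)%nat -> i <> a -> f i = g i) ->
        rsum m f - rsum m g = f a - g a).
      { induction m as [|m IHm]; intros f g a Ha Hfg; [lia|]; simpl.
        destruct (Nat.eq_dec a m) as [->|].
        - rewrite (rsum_ext m f g); [ring|]. intros; apply Hfg; lia.
        - rewrite (Hfg m) by lia. rewrite <- (IHm f g a); [ring|lia|].
          intros; apply Hfg; lia. }
      induction m as [|m IHm]; intros f g a b Hab Ha Hb Hfg; [lia|]; simpl.
      destruct (Nat.eq_dec a m) as [->|]; [|destruct (Nat.eq_dec b m) as [->|]].
      - rewrite <- (H1 m f g b); [ring|lia|]. intros; apply Hfg; lia.
      - rewrite <- (H1 m f g a); [ring|lia|]. intros; apply Hfg; lia.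
      - rewrite (Hfg m), <- (IHm f g a b); auto; [ring|lia|lia]. }
    match goal with |- rsum n ?f <= rsum n ?g =>
      assert (HH := Hsplit n f g u v Huv (proj1 He) (proj1 (proj2 He))) end.
    cbv beta in HH.
    rewrite !Nat.eqb_refl, (proj2 (Nat.eqb_neq v u)) in HH by auto.
    assert (Hk := Hphi u v (d v) (d u - 2)%nat He).
    replace (S (S (d u - 2))) with (d u) in Hk by lia.
    replace (d v + 1)%nat with (S (d v)) in HH by lia.
    assert (HH' := HH ltac:(intros i Hi Hj;
      rewrite (proj2 (Nat.eqb_neq i u)), (proj2 (Nat.eqb_neq i v)); auto)).
    lra.
Qed.

(** * The threshold *)

Lemma indicator_bounds P : 0 <= indicator P <= 1.
Proof. unfold indicator; destruct (excluded_middle_informative P); lra. Qed.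

Lemma indicator_true (P : Prop) : P -> indicator P = 1.
Proof. intros H; unfold indicator; destruct (excluded_middle_informative P); tauto. Qed.

Lemma indicator_false (P : Prop) : ~ P -> indicator P = 0.
Proof. intros H; unfold indicator; destruct (excluded_middle_informative P); tauto. Qed.

Lemma indicator_impl (P Q : Prop) : (P -> Q) -> indicator P <= indicator Q.
Proof.
  intros H; unfold indicator.
  destruct (excluded_middle_informative P), (excluded_middle_informative Q); try lra; tauto.
Qed.

Lemma indicator_not P : indicator (~ P) = 1 - indicator P.
Proof.
  unfold indicator.
  destruct (excluded_middle_informative P), (excluded_middle_informative (~ P));
    try lra; tauto.
Qed.

Lemma pow_one_sub_ge n e : 0 <= e <= 1 -> 1 - INR n * e <= (1 - e) ^ n.
Proof.
  intros He. rewrite <- rprod_const, <- rsum_const. apply rprod_one_sub; auto.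
Qed.

(** The failure probability [q = 1 - p] for [p = 1 / (1 + x / n)]; its odds [q / (1 - q) = x / n]
    are the mean number of pebbles on a vertex. *)
Definition ratio (n : nat) (x : R) : R := x / (INR n + x).

Lemma ratio_geom_param n x : (1 <= n)%nat -> 0 < x -> 1 - geom_param n x = ratio n x.
Proof.
  intros Hn Hx. apply le_INR in Hn; simpl in Hn. unfold geom_param, ratio.
  field. lra.
Qed.

Lemma ratio_bounds n x : (1 <= n)%nat -> 0 < x -> 0 < ratio n x < 1.
Proof.
  intros Hn Hx. apply le_INR in Hn; simpl in Hn. unfold ratio. split.
  - apply Rdiv_lt_0_compat; lra.
  - apply Rmult_lt_reg_r with (INR n + x); [lra|]. field_simplify; lra.
Qed.

Lemma ratio_lt n x y : (1 <= n)%nat -> 0 < x < y -> ratio n x < ratio n y.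
Proof.
  intros Hn Hx. apply le_INR in Hn; simpl in Hn. unfold ratio.
  apply Rmult_lt_reg_r with ((INR n + x) * (INR n + y)); [nra|].
  field_simplify; nra.
Qed.

Lemma ratio_surj n q : (1 <= n)%nat -> 0 < q < 1 -> exists x, 0 < x /\ ratio n x = q.
Proof.
  intros Hn Hq. apply le_INR in Hn; simpl in Hn. exists (INR n * q / (1 - q)). split.
  - apply Rdiv_lt_0_compat; nra.
  - unfold ratio. field. lra.
Qed.

Definition unsolv_box n adj M q : R := EM n M q (fun d => indicator (~ solvable n adj d)).

Lemma antitone_unsolvable n adj :
  simple_graph n adj -> antitone (fun d => indicator (~ solvable n adj d)).
Proof.
  intros Hg d d' H. apply indicator_impl. intros Hn Hs. apply Hn.
  eapply solvable_mono; eauto.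
Qed.

Lemma zero_not_solvable n adj : (1 <= n)%nat -> simple_graph n adj ->
  ~ solvable n adj (fun _ => O).
Proof.
  intros Hn Hg Hs. specialize (Hs O ltac:(lia)). apply pebblable_reach in Hs; auto.
  assert (H : forall d r, reach (edge_in n adj) d r -> (forall w, d w = O) -> False).
  { clear. intros d r H; induction H as [d r Hd|d d1 d2 u r Hs _ _ IH _ _]; intros H0.
    - rewrite H0 in Hd; lia.
    - apply IH; intros w; specialize (Hs w); rewrite H0 in Hs; lia. }
  eauto.
Qed.

Lemma solvable_of_large n adj :
  simple_graph n adj -> connected n adj ->
  exists N, forall d i, (i < n)%nat -> (N < d i)%nat -> solvable n adj d.
Proof.
  intros Hg Hc. destruct (connected_bounded_walks n adj Hc) as [D HD].
  exists (2 ^ D)%nat. intros d i Hi Hd r Hr. destruct (HD i r Hi Hr) as [k [Hk Hw]].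
  apply (pebblable_walk n adj k i r); auto.
  assert (2 ^ k <= 2 ^ D)%nat by (apply Nat.pow_le_mono_r; lia). lia.
Qed.

Lemma unsolv_box_stable n adj :
  simple_graph n adj -> connected n adj ->
  exists N, forall M q, (N <= M)%nat -> unsolv_box n adj M q = unsolv_box n adj N q.
Proof.
  intros Hg Hc. destruct (solvable_of_large n adj Hg Hc) as [N HN]. exists N.
  intros M q HM. apply EM_box_eq; auto. intros d i Hi Hd.
  apply indicator_false. intros Hs. apply Hs. eauto.
Qed.

Lemma solv_prob_partial_box n adj x M : (1 <= n)%nat -> 0 < x ->
  solv_prob_partial n adj x M = EM n M (ratio n x) (fun d => indicator (solvable n adj d)).
Proof.
  intros Hn Hx. unfold solv_prob_partial. rewrite EM_box_dists, ratio_geom_param; auto.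
Qed.

Lemma solv_unsolv n adj q M :
  EM n M q (fun d => indicator (solvable n adj d)) = (1 - q ^ S M) ^ n - unsolv_box n adj M q.
Proof.
  rewrite <- (Rmult_1_l ((1 - q ^ S M) ^ n)), <- EM_const. unfold unsolv_box.
  rewrite (EM_ext n M q (fun _ => 1)
    (fun d => indicator (solvable n adj d) + indicator (~ solvable n adj d))).
  - rewrite EM_plus; ring.
  - intros d; rewrite indicator_not; ring.
Qed.

(** The mass of the box tends to 1 as it grows, by Bernoulli's inequality with [q ^ S M] below
    [e / (n + 1)]. *)
Lemma mass_limit n q c b N : 0 <= q < 1 ->
  (forall M, (N <= M)%nat -> (1 - q ^ S M) ^ n - c <= b) -> 1 - c <= b.
Proof.
  intros Hq H. apply Rnot_lt_le; intros Hlt.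
  set (e := 1 - c - b) in *.
  assert (He : 0 < e / (INR n + 1)).
  { apply Rdiv_lt_0_compat; [unfold e; lra|]. assert (0 <= INR n) by apply pos_INR. lra. }
  destruct (pow_lt_1_zero q ltac:(rewrite Rabs_right; lra) _ He) as [N0 HN0].
  specialize (HN0 (S (N + N0)) ltac:(lia)). specialize (H (N + N0)%nat ltac:(lia)).
  set (w := q ^ S (N + N0)) in *.
  assert (0 <= w <= 1).
  { assert (A := mass_bounds (N + N0) q ltac:(lra)). fold w in A. lra. }
  rewrite Rabs_right in HN0 by lra.
  assert (B := pow_one_sub_ge n w ltac:(lra)).
  assert (0 <= INR n) by apply pos_INR.
  assert (w * (INR n + 1) < e).
  { apply Rmult_lt_reg_r with (/ (INR n + 1)); [apply Rinv_0_lt_compat; lra|].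
    rewrite Rmult_assoc, Rinv_r, Rmult_1_r by lra. exact HN0. }
  unfold e in *; nra.
Qed.

Lemma solv_prob_unsolv n adj N x : (1 <= n)%nat -> 0 < x ->
  (forall M q, (N <= M)%nat -> unsolv_box n adj M q = unsolv_box n adj N q) ->
  solv_prob n adj x (1 - unsolv_box n adj N (ratio n x)).
Proof.
  intros Hn Hx HN. assert (Hq := ratio_bounds n x Hn Hx). split.
  - intros s [M ->]. rewrite solv_prob_partial_box by auto.
    apply Rle_trans with
      (EM n (N + M) (ratio n x) (fun d => indicator (solvable n adj d))).
    + apply EM_box_le; [lra|intros; apply indicator_bounds|lia].
    + rewrite solv_unsolv, HN by lia.
      assert (A := mass_bounds (N + M) (ratio n x) ltac:(lra)).
      assert ((1 - ratio n x ^ S (N + M)) ^ n <= 1 ^ n) by (apply pow_incr; lra).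
      rewrite pow1 in *; lra.
  - intros b Hb. apply (mass_limit n (ratio n x) _ b N); [lra|].
    intros M HM. rewrite <- (HN M) by auto.
    rewrite <- solv_unsolv, <- solv_prob_partial_box by auto.
    apply Hb. now exists M.
Qed.

(* [threshold n adj x] records, besides that [x] is the threshold, the comparison of [x] with any
   [y] through the probability of insolvability at [y], which large boxes compute exactly. *)
Definition threshold (n : nat) (adj : nat -> nat -> bool) (x : R) : Prop :=
  0 < x /\ is_geom_threshold n adj x /\
  exists N, (forall M q, (N <= M)%nat -> unsolv_box n adj M q = unsolv_box n adj N q) /\
    unsolv_box n adj N (ratio n x) = 1 / 2 /\
    forall y, 0 < y ->
      (unsolv_box n adj N (ratio n y) <= 1 / 2 -> x <= y) /\
      (1 / 2 <= unsolv_box n adj N (ratio n y) -> y <= x).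

Lemma EM_zero_ratio k M F : EM k M 0 F = F (fun _ => O).
Proof.
  revert F; induction k as [|k IH]; intros F; simpl; auto. rewrite IH.
  assert (H : forall g, gsum M 0 g = g O) by (intros g; destruct M; simpl; ring).
  rewrite H. f_equal. extensionality i. unfold upd. now destruct (Nat.eqb i k).
Qed.

Lemma threshold_exists n adj :
  (1 <= n)%nat -> simple_graph n adj -> connected n adj -> exists x, threshold n adj x.
Proof.
  intros Hn Hg Hc. destruct (unsolv_box_stable n adj Hg Hc) as [N HN].
  set (u := unsolv_box n adj N) in *.
  assert (Hzero : indicator (~ solvable n adj (fun _ => O)) = 1)
    by (apply indicator_true, zero_not_solvable; auto).
  assert (Hlt : forall q q', 0 < q < q' -> q' < 1 -> u q' < u q).
  { intros q q' Hq Hq'. apply EM_antitone_param; auto; try lra; try lia.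
    - now apply antitone_unsolvable.
    - intros; apply indicator_bounds. }
  assert (H0 : u 0 = 1) by (unfold u, unsolv_box; rewrite EM_zero_ratio; auto).
  (* Ratio 1 is not a distribution, but for the fixed box [u] is a polynomial in [q] and its mass
     vanishes there, which gives the second endpoint for the intermediate value theorem. *)
  assert (H1 : u 1 <= 0).
  { apply Rle_trans with (EM n N 1 (fun _ => 1)).
    - apply EM_le; [lra|]. intros; apply indicator_bounds.
    - rewrite EM_const, pow1. replace (1 - 1) with 0 by ring. rewrite pow_i by lia. lra. }
  destruct (IVT (fun q => 1 / 2 - u q) 0 1) as [q [Hq Eq]].
  - apply (continuity_minus (fun _ => 1 / 2) u).
    + apply continuity_const; intros a b; reflexivity.
    + apply (continuity_EM n N (fun _ d => indicator (~ solvable n adj d))).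
      intros d; apply continuity_const; intros a b; reflexivity.
  - lra.
  - lra.
  - lra.
  - cbv beta in Eq. assert (q <> 0) by (intros ->; lra). assert (q <> 1) by (intros ->; lra).
    destruct (ratio_surj n q Hn ltac:(lra)) as [x [Hx <-]]. clear Hq H H2.
    assert (Hcmp : forall y, 0 < y ->
      (u (ratio n y) <= 1 / 2 -> x <= y) /\ (1 / 2 <= u (ratio n y) -> y <= x)).
    { intros y Hy. split; intros H; apply Rnot_lt_le; intros Hxy.
      - assert (A := Hlt _ _ (conj (proj1 (ratio_bounds n y Hn Hy)) (ratio_lt n y x Hn (conj Hy Hxy)))
                   (proj2 (ratio_bounds n x Hn Hx))). lra.
      - assert (A := Hlt _ _ (conj (proj1 (ratio_bounds n x Hn Hx)) (ratio_lt n x y Hn (conj Hx Hxy)))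
                   (proj2 (ratio_bounds n y Hn Hy))). lra. }
    assert (Hsp := fun y Hy => solv_prob_unsolv n adj N y Hn Hy HN). fold u in Hsp.
    exists x. split; [auto|split]; [split; [auto|split]|].
    + replace (1 / 2) with (1 - u (ratio n x)) by lra. auto.
    + intros y Hy Hp.
      assert (E : 1 / 2 = 1 - u (ratio n y)) by (eapply is_lub_u; [exact Hp|apply Hsp; auto]).
      destruct (Hcmp y Hy) as [A B]. apply Rle_antisym; [apply B|apply A]; lra.
    + exists N; split; [auto|split; [change (u (ratio n x) = 1 / 2); lra|exact Hcmp]].
Qed.

Lemma threshold_le n adj x y : threshold n adj x -> 0 < y ->
  (forall M, unsolv_box n adj M (ratio n y) <= 1 / 2) -> x <= y.
Proof. intros [_ [_ [N [_ [_ H]]]]] Hy HM. apply H; auto. Qed.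

(** Solvability is not confined to a box, so the estimate passes to the limit of large boxes. Asking
    it only from [N'] on allows bounds that require the box to contain given pebble numbers. *)
Lemma threshold_ge n adj x y N' : (1 <= n)%nat -> threshold n adj x -> 0 < y ->
  (forall M, (N' <= M)%nat ->
     EM n M (ratio n y) (fun d => indicator (solvable n adj d)) <= 1 / 2) -> y <= x.
Proof.
  intros Hn [_ [_ [N [HN [_ H]]]]] Hy HM. apply H; auto.
  assert (Hq := ratio_bounds n y Hn Hy).
  assert (1 - unsolv_box n adj N (ratio n y) <= 1 / 2); [|lra].
  apply (mass_limit n (ratio n y) _ _ (N + N')); [lra|]. intros M HM'.
  rewrite <- (HN M), <- solv_unsolv by lia. apply HM; lia.
Qed.

(** With [q] the ratio at [x'] and [s = sqrt q], the halving shows that the old graph is unsolvable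
    with probability at most 1/2 at the [y] of ratio [s]. Since [y = n s / (1 - s)] and
    [x' + n = n / (1 - s ^ 2)], one has [y = (x' + n) s (1 + s)]. *)
Lemma threshold_add_edge n adj u v w x x' :
  (1 <= n)%nat -> simple_graph n adj -> u <> v -> edge_in n adj u w -> edge_in n adj w v ->
  threshold n adj x -> threshold n (add_edge u v adj) x' -> x <= 2 * (x' + INR n).
Proof.
  intros Hn Hg Huv Huw Hwv [Hx [_ [N [HN [_ H]]]]] [Hx' [_ [N' [HN' [E' _]]]]].
  assert (Hn' := le_INR _ _ Hn); simpl in Hn'.
  assert (Hq := ratio_bounds n x' Hn Hx').
  set (q := ratio n x') in *. set (s := sqrt q).
  assert (Hs : 0 < s < 1).
  { split; [apply sqrt_lt_R0; lra|]. rewrite <- sqrt_1. apply sqrt_lt_1; lra. }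
  assert (Hss : s * s = q) by (apply sqrt_sqrt; lra).
  destruct (ratio_surj n s Hn Hs) as [y [Hy Ey]].
  apply Rle_trans with y.
  (* Both boxes are enlarged to the sizes [2 M + 1] and [M] that [EM_half] relates. *)
  - apply H; auto. rewrite Ey, <- E', <- (HN (2 * (N + N') + 1)%nat), <- (HN' (N + N')%nat) by lia.
    rewrite <- Hss. apply EM_half; [lra|]. intros d d' Hd. apply indicator_impl.
    intros Hns Hsol. apply Hns. apply (solvable_add_edge n adj u v w d d'); auto.
  - assert (Hy' : y * (1 - s) = INR n * s).
    { rewrite <- Ey. unfold ratio. field. lra. }
    assert (Hx'' : x' * (1 - s * s) = INR n * (s * s)).
    { rewrite Hss. unfold q, ratio. field. lra. }
    assert ((x' + INR n) * (1 - s * s) = INR n) by nra.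
    apply Rmult_le_reg_r with (1 - s); [lra|]. rewrite Hy'.
    assert (0 < x' + INR n) by lra.
    assert ((x' + INR n) * (1 - s * s) * s = INR n * s) by nra.
    assert ((x' + INR n) * (1 - s) * ((1 + s) * s) <= (x' + INR n) * (1 - s) * 2).
    { apply Rmult_le_compat_l; nra. }
    nra.
Qed.

(** * Descent to the complete graph *)

Definition complete_adj (u v : nat) : bool := negb (Nat.eqb u v).

Lemma complete_simple n : simple_graph n complete_adj.
Proof.
  intros u v _ _; unfold complete_adj. rewrite Nat.eqb_refl, Nat.eqb_sym. auto.
Qed.

Lemma complete_connected n : connected n complete_adj.
Proof.
  intros u v Hu Hv. destruct (Nat.eq_dec u v) as [->|H]; [apply rt_refl|].
  apply rt_step. repeat split; auto. unfold complete_adj.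
  now rewrite (proj2 (Nat.eqb_neq u v)).
Qed.

(** Any vertex with two pebbles solves the graph. At mean 3 the ratio is [3 / 4], and all vertices
    have at most one pebble with probability at most [(7 / 16) ^ n < 1 / 2]. *)
Lemma threshold_complete n adj x :
  (1 <= n)%nat -> simple_graph n adj ->
  (forall u v, (u < n)%nat -> (v < n)%nat -> u <> v -> adj u v = true) ->
  threshold n adj x -> x <= 3 * INR n.
Proof.
  intros Hn Hg Hadj Hthr. assert (Hn' := le_INR _ _ Hn); simpl in Hn'.
  apply (threshold_le n adj x (3 * INR n) Hthr); [lra|]. intros M.
  assert (E : ratio n (3 * INR n) = 3 / 4) by (unfold ratio; field; lra).
  rewrite E.
  apply Rle_trans with (EM n M (3 / 4)
    (fun d => rprod n (fun i => if (d i <=? 1)%nat then 1 else 0))).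
  - apply EM_le; [lra|]. intros d.
    destruct (classic (forall i, (i < n)%nat -> (d i <= 1)%nat)) as [H|H].
    + rewrite rprod_eq_1; [apply indicator_bounds|].
      intros i Hi. now rewrite (proj2 (Nat.leb_le _ _)) by auto.
    + rewrite indicator_false.
      * apply rprod_nonneg; intros i _; destruct (d i <=? 1)%nat; lra.
      * intros Hns; apply Hns. intros r Hr.
        apply not_all_ex_not in H. destruct H as [i Hi].
        apply imply_to_and in Hi. destruct Hi as [Hi Hd].
        destruct (Nat.eq_dec i r) as [->|Hir].
        -- apply (pebblable_walk n adj 0 r r); auto; [constructor|simpl; lia].
        -- apply (pebblable_walk n adj 1 i r); auto; [|simpl; lia].
           econstructor; [|constructor]. repeat split; auto.
  - rewrite (EM_prod n M (3 / 4) (fun _ a => if (a <=? 1)%nat then 1 else 0)).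
    rewrite rprod_const.
    assert (A : 0 <= gsum M (3 / 4) (fun a => if (a <=? 1)%nat then 1 else 0) <= 7 / 16).
    { split.
      - apply gsum_nonneg; [lra|]. intros a; destruct (a <=? 1)%nat; lra.
      - apply Rle_trans with (gsum (S M) (3 / 4) (fun a => if (a <=? 1)%nat then 1 else 0)).
        + apply gsum_box_le; [lra| |lia]. intros a; destruct (a <=? 1)%nat; lra.
        + rewrite gsum_le_indicator by lia. simpl; lra. }
    destruct n as [|n]; [lia|]. simpl pow.
    assert (B : 0 <= gsum M (3 / 4) (fun a => if (a <=? 1)%nat then 1 else 0) ^ n <= 1 ^ n).
    { split; [apply pow_le; lra|apply pow_incr; lra]. }
    rewrite pow1 in B. nra.
Qed.

(** A termination measure; it counts ordered pairs and includes the diagonal, since only its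
    decrease matters. *)
Definition missing (n : nat) (adj : nat -> nat -> bool) : nat :=
  length (filter (fun p => negb (adj (fst p) (snd p))) (list_prod (seq 0 n) (seq 0 n))).

Lemma missing_add_edge n adj u v :
  (u < n)%nat -> (v < n)%nat -> adj u v = false ->
  (missing n (add_edge u v adj) < missing n adj)%nat.
Proof.
  intros Hu Hv Ha. unfold missing.
  assert (Hin : In (u, v) (list_prod (seq 0 n) (seq 0 n))).
  { apply in_prod; apply in_seq; lia. }
  induction (list_prod (seq 0 n) (seq 0 n)) as [|[a b] l IH]; [destruct Hin|].
  assert (Hle : forall l, (length (filter (fun p => negb (add_edge u v adj (fst p) (snd p))) l) <=
    length (filter (fun p => negb (adj (fst p) (snd p))) l))%nat).
  { clear. induction l as [|[a b] l IH]; [auto|]. cbn [filter fst snd]. unfold add_edge at 1.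
    destruct (adj a b); simpl; [auto|].
    destruct (a =? u)%nat, (b =? v)%nat, (a =? v)%nat, (b =? u)%nat; simpl; lia. }
  cbn [filter fst snd]. destruct Hin as [E|Hin].
  - injection E as -> ->. unfold add_edge at 1. rewrite Ha, !Nat.eqb_refl. simpl.
    specialize (Hle l); lia.
  - specialize (IH Hin). unfold add_edge at 1.
    destruct (adj a b); simpl; [auto|].
    destruct (a =? u)%nat, (b =? v)%nat, (a =? v)%nat, (b =? u)%nat; simpl; lia.
Qed.

(* Descending from [adj] to the complete graph one edge at a time, the threshold drops by a bounded
   factor in each step, so it cannot jump over the target [t]. *)
Lemma threshold_interpolation n adj x t c :
  (1 <= n)%nat -> simple_graph n adj -> connected n adj -> threshold n adj x ->
  0 <= c <= 1 -> INR n <= t -> c * t <= x ->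
  exists adj' x', simple_graph n adj' /\ connected n adj' /\ threshold n adj' x' /\
    c * t <= x' <= 4 * t.
Proof.
  intros Hn. remember (missing n adj) as m eqn:Hm. revert adj x Hm.
  induction m as [m IH] using lt_wf_ind; intros adj x Hm Hg Hc Hthr Hcc Ht Hx.
  destruct (Rle_lt_dec x (4 * t)) as [Hle|Hgt]; [exists adj, x; auto|].
  destruct (classic (exists u v, (u < n)%nat /\ (v < n)%nat /\ u <> v /\ adj u v = false))
    as [Hmiss|Hfull].
  - destruct (exists_distance_two n adj Hc Hmiss) as [u [w [v [Huv [Ha [Huw Hwv]]]]]].
    destruct (threshold_exists n (add_edge u v adj)) as [x' Hx']; auto.
    { now apply add_edge_simple. }
    { now apply add_edge_connected. }
    assert (A := threshold_add_edge n adj u v w x x' Hn Hg Huv Huw Hwv Hthr Hx').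
    assert (Hlt : (missing n (add_edge u v adj) < m)%nat).
    { rewrite Hm. apply missing_add_edge; auto; [apply Huw|apply Hwv]. }
    apply (IH _ Hlt (add_edge u v adj) x'); auto.
    + now apply add_edge_simple.
    + now apply add_edge_connected.
    (* From [x > 4 t] and [n <= t] follows [x' >= x / 2 - n > t]. The factor [c] thus serves the
       starting graph, whose threshold may lie below [t]. *)
    + assert (0 <= INR n) by apply pos_INR. nra.
  - exfalso. assert (x <= 3 * INR n).
    { apply (threshold_complete n adj); auto. intros u v Hu Hv Huv.
      destruct (adj u v) eqn:E; auto. exfalso; apply Hfull; eauto 10. }
    assert (0 <= INR n) by apply pos_INR. lra.
Qed.

(** * Spiders *)

(* [s] legs of length [L] are attached to the hub [s * L]; vertex [j * L + i] with [i < L] has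
   distance [i] from the tip of leg [j], and all vertices beyond the hub are leaves adjacent to it. *)
Definition spider_next (s L v : nat) : nat :=
  if (v <? s * L)%nat then (if (S v mod L =? 0)%nat then (s * L)%nat else S v) else (s * L)%nat.

(** Symmetric closure of [spider_next]; the hub is its own successor, hence the explicit exclusion
    of loops. *)
Definition spider_adj (s L u v : nat) : bool :=
  negb (Nat.eqb u v) && (Nat.eqb (spider_next s L u) v || Nat.eqb (spider_next s L v) u).

Lemma spider_simple n s L : simple_graph n (spider_adj s L).
Proof.
  intros u v _ _. unfold spider_adj. rewrite (Nat.eqb_sym v u), Nat.eqb_refl.
  split; auto. now rewrite Bool.orb_comm.
Qed.

Lemma spider_edge n s L u v :
  edge_in n (spider_adj s L) u v -> u <> v /\ (v = spider_next s L u \/ u = spider_next s L v).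
Proof.
  intros [_ [_ H]]. unfold spider_adj in H. apply andb_prop in H. destruct H as [H1 H2].
  apply Bool.negb_true_iff, Nat.eqb_neq in H1. split; auto.
  apply Bool.orb_true_iff in H2. destruct H2 as [H2|H2]; apply Nat.eqb_eq in H2; auto.
Qed.

Lemma spider_edge_next n s L v :
  (v < n)%nat -> (spider_next s L v < n)%nat -> v <> spider_next s L v ->
  edge_in n (spider_adj s L) v (spider_next s L v) /\
  edge_in n (spider_adj s L) (spider_next s L v) v.
Proof.
  intros Hv Hw Hne. unfold spider_adj; repeat split; auto;
    rewrite Nat.eqb_refl, ?Bool.orb_true_r; simpl; rewrite Bool.andb_true_r;
    apply Bool.negb_true_iff, Nat.eqb_neq; auto.
Qed.

Lemma spider_connected n s L : (s * L < n)%nat -> connected n (spider_adj s L).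
Proof.
  intros Hn.
  assert (H : forall m v, (v < n)%nat -> (s * L - v <= m)%nat ->
    clos_refl_trans nat (edge_in n (spider_adj s L)) v (s * L)%nat /\
    clos_refl_trans nat (edge_in n (spider_adj s L)) (s * L)%nat v).
  { assert (H1 : forall v, (v < n)%nat -> spider_next s L v = (s * L)%nat ->
      clos_refl_trans nat (edge_in n (spider_adj s L)) v (s * L)%nat /\
      clos_refl_trans nat (edge_in n (spider_adj s L)) (s * L)%nat v).
    { intros v Hv E. destruct (Nat.eq_dec v (s * L)) as [->|Hne]; [split; apply rt_refl|].
      rewrite <- E. rewrite <- E in Hn, Hne.
      destruct (spider_edge_next n s L v Hv Hn Hne). split; apply rt_step; auto. }
    induction m as [|m IH]; intros v Hv Hm.
    - apply H1; auto. unfold spider_next. rewrite (proj2 (Nat.ltb_ge _ _)) by lia. auto.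
    - destruct (Nat.eq_dec (spider_next s L v) (s * L)) as [E|Hne]; auto.
      assert (E : (v < s * L)%nat /\ spider_next s L v = S v).
      { unfold spider_next in *. destruct (Nat.ltb_spec v (s * L)); [|lia].
        destruct (S v mod L =? 0)%nat; [lia|auto]. }
      destruct E as [Hlt E].
      destruct (spider_edge_next n s L v) as [A B]; try lia.
      rewrite E in A, B. destruct (IH (S v)) as [C D]; try lia.
      split; [apply rt_trans with (S v)|apply rt_trans with (S v)]; auto; now apply rt_step. }
  intros u v Hu Hv. apply rt_trans with (s * L)%nat.
  - apply (H (s * L)%nat); auto; lia.
  - apply (H (s * L)%nat); auto; lia.
Qed.

(** * Brooms: spiders with a single leg, far end 0 and hub [L] *)

Lemma broom_next L v : spider_next 1 L v = if (v <? L)%nat then S v else L.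
Proof.
  unfold spider_next. rewrite Nat.mul_1_l. destruct (Nat.ltb_spec v L) as [H|H]; auto.
  destruct (Nat.eq_dec (S v) L) as [E|E].
  - now destruct (S v mod L =? 0)%nat.
  - rewrite Nat.mod_small by lia. auto.
Qed.

Lemma broom_walk n L v : (L < n)%nat -> (v < n)%nat ->
  exists k, (k <= S L)%nat /\ walk n (spider_adj 1 L) k L v.
Proof.
  intros HL Hv. destruct (le_lt_dec v L) as [Hle|Hlt].
  - exists (L - v)%nat; split; [lia|].
    assert (H : forall m v, (m + v = L)%nat -> forall j w, walk n (spider_adj 1 L) j v w ->
      walk n (spider_adj 1 L) (m + j) L w).
    { clear v Hv Hle. induction m as [|m IH]; intros v Hm j w Hw.
      - simpl in Hm; subst v; auto.
      - replace (S m + j)%nat with (m + S j)%nat by lia. apply (IH (S v)); [lia|].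
        econstructor; [|exact Hw].
        assert (E := broom_next L v). rewrite (proj2 (Nat.ltb_lt v L)) in E by lia.
        rewrite <- E. apply spider_edge_next; rewrite ?E; lia. }
    rewrite <- (Nat.add_0_r (L - v)). apply (H _ v); [lia|constructor].
  - exists 1%nat; split; [lia|]. econstructor; [|constructor].
    assert (E := broom_next L v). rewrite (proj2 (Nat.ltb_ge v L)) in E by lia.
    destruct (spider_edge_next n 1 L v) as [_ A]; rewrite ?E in *; auto; lia.
Qed.

Fixpoint count (P : nat -> bool) (b : nat) : nat :=
  match b with O => O | S b' => (count P b' + if P b' then 1 else 0)%nat end.

(** Each leaf holding a pair sends one pebble to the hub; the last clause keeps the leaves not yet
    treated intact for the induction. *)
Lemma broom_gather n L d b : (L < n)%nat -> (b <= n)%nat ->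
  exists d', steps n (spider_adj 1 L) d d' /\
    (count (fun v => (L <? v)%nat && (2 <=? d v)%nat)%bool b <= d' L)%nat /\
    forall w, (b <= w)%nat -> w <> L -> d' w = d w.
Proof.
  intros HL; induction b as [|b IH]; intros Hb.
  - exists d; repeat split; [apply rt_refl|simpl; lia].
  - destruct IH as [d1 [Hs [Hc Hd]]]; [lia|]. cbn [count].
    destruct (Nat.ltb_spec L b) as [HLb|HLb]; cbn [andb].
    2:{ exists d1; repeat split; auto; [lia|]. intros; apply Hd; lia. }
    destruct (Nat.leb_spec 2 (d b)) as [H2|H2].
    2:{ exists d1; repeat split; auto; [lia|]. intros; apply Hd; lia. }
    assert (He : edge_in n (spider_adj 1 L) b L).
    { assert (E := broom_next L b). rewrite (proj2 (Nat.ltb_ge b L)) in E by lia.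
      destruct (spider_edge_next n 1 L b) as [A _]; rewrite ?E in *; auto; lia. }
    assert (Hdb : d1 b = d b) by (apply Hd; lia).
    eexists; split;
      [eapply rt_trans;
       [exact Hs
       |apply rt_step; exists b, L; split; [exact He|split; [lia|reflexivity]]]|].
    cbv beta. split.
    + rewrite (proj2 (Nat.eqb_neq L b)), Nat.eqb_refl by lia. lia.
    + intros w Hw HwL. rewrite (proj2 (Nat.eqb_neq w b)), (proj2 (Nat.eqb_neq w L)) by lia.
      apply Hd; lia.
Qed.

Lemma broom_solvable n L d : (L < n)%nat ->
  (2 ^ S L <= count (fun v => (L <? v)%nat && (2 <=? d v)%nat)%bool n)%nat ->
  solvable n (spider_adj 1 L) d.
Proof.
  intros HL Hc r Hr. destruct (broom_gather n L d n HL (le_n n)) as [d1 [Hs [Hd _]]].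
  destruct (broom_walk n L r HL Hr) as [k [Hk Hw]].
  assert (2 ^ k <= 2 ^ S L)%nat by (apply Nat.pow_le_mono_r; lia).
  destruct (pebblable_walk n (spider_adj 1 L) k L r d1) as [d2 [Hs2 H2]]; auto.
  - apply spider_simple.
  - lia.
  - exists d2; split; auto. now apply rt_trans with d1.
Qed.

(** An exponential Markov bound. If [c] leaves hold a pair, insolvability forces [c < 2 ^ S L], so
    its indicator is at most [2 ^ (2 ^ S L) * (1 / 2) ^ c]. The expectation of [(1 / 2) ^ c]
    factorizes, and a leaf, which holds a pair with probability [q ^ 2], contributes at most
    [1 - q ^ 2 / 2]. *)
Lemma broom_unsolvable_prob n L M q : (L < n)%nat -> 0 <= q <= 1 ->
  unsolv_box n (spider_adj 1 L) M q <= 2 ^ (2 ^ S L) * (1 - q ^ 2 / 2) ^ (n - S L).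
Proof.
  intros HL Hq.
  set (g := fun v a => if ((L <? v)%nat && (2 <=? a)%nat)%bool then 1 / 2 else 1).
  assert (Hg : forall v a, 1 / 2 <= g v a <= 1).
  { intros v a; unfold g. destruct ((L <? v)%nat && (2 <=? a)%nat)%bool; lra. }
  apply Rle_trans with (2 ^ (2 ^ S L) * EM n M q (fun d => rprod n (fun v => g v (d v)))).
  - rewrite <- EM_scal. apply EM_le; auto. intros d.
    assert (E : forall b, rprod b (fun v => g v (d v)) =
              (1 / 2) ^ count (fun v => (L <? v)%nat && (2 <=? d v)%nat)%bool b).
    { induction b as [|b IH]; cbn [rprod count]; auto. rewrite IH, pow_add. unfold g.
      destruct ((L <? b)%nat && (2 <=? d b)%nat)%bool; simpl; lra. }
    rewrite E. set (c := count _ n).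
    destruct (le_lt_dec (2 ^ S L) c) as [Hc|Hc].
    + rewrite indicator_false.
      * apply Rmult_le_pos; apply pow_le; lra.
      * intros H; apply H. now apply broom_solvable.
    + apply Rle_trans with 1; [apply indicator_bounds|].
      replace (2 ^ S L)%nat with (c + (2 ^ S L - c))%nat by lia.
      rewrite pow_add. rewrite (Rmult_comm (2 ^ c)), Rmult_assoc, <- Rpow_mult_distr.
      replace (2 * (1 / 2)) with 1 by field. rewrite pow1, Rmult_1_r.
      apply pow_R1_Rle; lra.
  - apply Rmult_le_compat_l; [apply pow_le; lra|].
    rewrite EM_prod. replace n with (S L + (n - S L))%nat at 1 by lia.
    rewrite rprod_app. rewrite <- (Rmult_1_l ((1 - q ^ 2 / 2) ^ _)).
    assert (H0 : forall v, 0 <= gsum M q (g v)).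
    { intros v; apply gsum_nonneg; auto. intros a; destruct (Hg v a); lra. }
    apply Rmult_le_compat; try (apply rprod_nonneg; auto).
    + rewrite <- (pow1 (S L)), <- rprod_const. apply rprod_le. intros i _; split; auto.
      apply Rle_trans with (gsum M q (fun _ => 1)).
      * apply gsum_le; auto; intros; apply Hg.
      * apply gsum_const_le; lra.
    + rewrite <- rprod_const. apply rprod_le. intros i _; split; auto.
      assert (E0 : g (S L + i)%nat O = 1).
      { unfold g. now rewrite Bool.andb_false_r. }
      assert (E1 : g (S L + i)%nat 1%nat = 1).
      { unfold g. now rewrite Bool.andb_false_r. }
      assert (E2 : forall a, g (S L + i)%nat (S (S a)) = 1 / 2).
      { intros a. unfold g. now rewrite (proj2 (Nat.ltb_lt L (S L + i))) by lia. }
      destruct M as [|[|M]]; cbn [gsum]; rewrite ?E0, ?E1.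
      * nra.
      * nra.
      * rewrite (gsum_ext _ _ _ (fun _ => 1 / 2)) by (intros; apply E2).
        assert (A := gsum_const_le M q (1 / 2) Hq ltac:(lra)).
        assert (q * (q * gsum M q (fun _ => 1 / 2)) <= q * (q * (1 / 2))).
        { apply Rmult_le_compat_l; [lra|]. apply Rmult_le_compat_l; lra. }
        nra.
Qed.

Lemma ratio_odds n y : (1 <= n)%nat -> 0 < y -> ratio n y / (1 - ratio n y) = y / INR n.
Proof.
  intros Hn Hy. apply le_INR in Hn; simpl in Hn. unfold ratio. field. lra.
Qed.

Lemma half_pow_S k : (1 / 2) ^ k = 2 * (1 / 2) ^ S k.
Proof. simpl; field. Qed.

Lemma half_pow_pos k : 0 < (1 / 2) ^ k.
Proof. apply pow_lt; lra. Qed.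

Lemma INR_div2_step k : INR (S (S k) / 2) = INR (k / 2) + 1.
Proof.
  replace (S (S k)) with (k + 1 * 2)%nat by lia.
  rewrite Nat.div_add by lia. now rewrite plus_INR.
Qed.

Lemma INR_div2_S k : INR (k / 2) <= INR (S k / 2) <= INR (k / 2) + 1.
Proof.
  split.
  - apply le_INR. apply Nat.Div0.div_le_mono; lia.
  - rewrite <- INR_div2_step. apply le_INR. apply Nat.Div0.div_le_mono; lia.
Qed.

(* The vertices beyond the hub enter the weight through their pairs only: a single pebble there
   cannot be moved. *)
Lemma broom_solvable_prob n L M y : (L < n)%nat -> 0 < y ->
  EM n M (ratio n y) (fun d => indicator (solvable n (spider_adj 1 L) d)) <=
  2 * (y / INR n) +
  INR n * ((1 / 2) ^ L * (ratio n y ^ 2 / (1 - ratio n y ^ 2))).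
Proof.
  intros HL Hy. assert (Hq := ratio_bounds n y ltac:(lia) Hy).
  assert (Hodds := ratio_odds n y ltac:(lia) Hy).
  set (q := ratio n y) in *. rewrite <- Hodds.
  assert (Hl : 0 <= q / (1 - q)) by (apply Rle_mult_inv_pos; lra).
  assert (Hq2 : 0 <= q ^ 2 / (1 - q ^ 2)) by (apply Rle_mult_inv_pos; simpl; nra).
  set (phi := fun v k => if (v <=? L)%nat then (1 / 2) ^ v * INR k else (1 / 2) ^ L * INR (k / 2)).
  set (e := fun v => if (v <=? L)%nat then (1 / 2) ^ v * (q / (1 - q))
                     else (1 / 2) ^ L * (q ^ 2 / (1 - q ^ 2))).
  assert (Hphi0 : forall v k, 0 <= phi v k).
  { intros v k; unfold phi. destruct (v <=? L)%nat;
      apply Rmult_le_pos; try apply pos_INR; apply pow_le; lra. }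
  apply Rle_trans with (EM n M q (fun d => rsum n (fun v => phi v (d v)))).
  - apply EM_le; [lra|]. intros d.
    destruct (classic (solvable n (spider_adj 1 L) d)) as [Hs|Hs].
    2:{ rewrite indicator_false by auto. apply rsum_nonneg; auto. }
    rewrite indicator_true by auto.
    replace 1 with (phi 0%nat 1%nat) by (unfold phi; simpl; lra).
    apply (potential_bound n (spider_adj 1 L)); auto.
    + lia.
    + apply spider_simple.
    + intros k. unfold phi. rewrite (proj2 (Nat.leb_le 0 L)), S_INR by lia.
      assert (A := half_pow_pos 0). nra.
    + intros u v j k He. destruct (spider_edge _ _ _ _ _ He) as [Huv Hnext].
      rewrite !broom_next in Hnext. unfold phi.
      assert (A := INR_div2_S j). assert (B := INR_div2_step k).
      assert (C := half_pow_pos L).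
      (* Within the leg the weight halves with each step away from 0. From leaf to hub, a pair worth
         [(1 / 2) ^ L] becomes one pebble of the same worth. From hub to leaf, two such pebbles are
         lost and at most one pair is gained. Two leaves are never adjacent. *)
      destruct (Nat.leb_spec v L) as [HvL|HvL], (Nat.leb_spec u L) as [HuL|HuL].
      * assert (Hc : v = S u \/ u = S v).
        { destruct (Nat.ltb_spec u L), (Nat.ltb_spec v L); lia. }
        rewrite !S_INR. destruct Hc as [-> | ->].
        -- assert (D := half_pow_S u). assert (F := half_pow_pos (S u)). nra.
        -- assert (D := half_pow_S v). nra.
      * assert (v = L) as -> by (destruct (Nat.ltb_spec u L), (Nat.ltb_spec v L); lia).
        rewrite !S_INR, B. nra.
      * assert (u = L) as -> by (destruct (Nat.ltb_spec u L), (Nat.ltb_spec v L); lia).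
        rewrite !S_INR. nra.
      * exfalso. destruct (Nat.ltb_spec u L), (Nat.ltb_spec v L); lia.
    + apply Hs; lia.
  - apply Rle_trans with (rsum n e).
    + apply EM_sum_le; [lra|auto|]. intros v _. unfold phi, e.
      destruct (v <=? L)%nat.
      * rewrite gsum_scal. apply Rmult_le_compat_l; [apply pow_le; lra|].
        apply (gsum_id_le M q); lra.
      * rewrite gsum_scal. apply Rmult_le_compat_l; [apply pow_le; lra|].
        apply gsum_div2_le; lra.
    + replace n with (S L + (n - S L))%nat at 1 by lia. rewrite rsum_app.
      apply Rplus_le_compat.
      * rewrite (rsum_ext _ _ (fun v => (q / (1 - q)) * (1 / 2) ^ v)).
        -- eapply Rle_trans; [apply rsum_geom; [auto|lra]|].
           right; field; lra.
        -- intros i Hi. unfold e. rewrite (proj2 (Nat.leb_le i L)) by lia. ring.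
      * rewrite (rsum_ext _ _ (fun _ => (1 / 2) ^ L * (q ^ 2 / (1 - q ^ 2)))).
        -- rewrite rsum_const. apply Rmult_le_compat_r.
           ++ apply Rmult_le_pos; auto. apply pow_le; lra.
           ++ apply le_INR; lia.
        -- intros i Hi. unfold e. rewrite (proj2 (Nat.leb_gt (S L + i) L)) by lia. auto.
Qed.

(** * Spiders with many legs *)

(** Distance from the tip of leg [j], capped at that of the hub: every vertex off the leg counts as
    [L]. The cap keeps it changing by at most one along edges. *)
Definition leg_dist (L j v : nat) : nat :=
  if ((j * L <=? v)%nat && (v <? j * L + L)%nat)%bool then (v - j * L)%nat else L.

Lemma leg_dist_next s L j u : (0 < L)%nat -> (j < s)%nat ->
  (leg_dist L j u <= S (leg_dist L j (spider_next s L u)) /\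
   leg_dist L j (spider_next s L u) <= S (leg_dist L j u))%nat.
Proof.
  intros HL Hj. assert (Hjs : (j * L + L <= s * L)%nat) by nia.
  assert (Hhub : leg_dist L j (s * L) = L).
  { unfold leg_dist. rewrite (proj2 (Nat.ltb_ge (s * L) (j * L + L))) by lia.
    now rewrite Bool.andb_false_r. }
  unfold spider_next.
  destruct (Nat.ltb_spec u (s * L)) as [Hu|Hu].
  - destruct (Nat.eqb_spec (S u mod L) 0) as [E|E].
    + rewrite Hhub. unfold leg_dist.
      destruct (Nat.leb_spec (j * L) u), (Nat.ltb_spec u (j * L + L)); simpl; try lia.
      assert (S u = (j * L + L)%nat); [|lia].
      destruct (Nat.eq_dec (S u) (j * L + L)) as [|Hne]; auto. exfalso.
      replace (S u) with (S (u - j * L) + j * L)%nat in E by lia.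
      rewrite Nat.Div0.mod_add, Nat.mod_small in E by lia. lia.
    + assert (S u <> j * L)%nat.
      { intros H. rewrite H, Nat.Div0.mod_mul in E. lia. }
      assert (S u <> j * L + L)%nat.
      { intros H'. replace (j * L + L)%nat with (S j * L)%nat in H' by lia.
        rewrite H', Nat.Div0.mod_mul in E. lia. }
      unfold leg_dist.
      destruct (Nat.leb_spec (j * L) u), (Nat.ltb_spec u (j * L + L)),
        (Nat.leb_spec (j * L) (S u)), (Nat.ltb_spec (S u) (j * L + L)); cbn [andb]; lia.
  - rewrite Hhub. unfold leg_dist.
    rewrite (proj2 (Nat.ltb_ge u (j * L + L))), Bool.andb_false_r by lia. lia.
Qed.

(** The weight of a pebble is 2 to the power minus [leg_dist]. Charging [(1 / 2) ^ L] to all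
    vertices counts the leg twice, but makes the second term a multiple of the total number of
    pebbles, the same for all legs. *)
Lemma spider_tip_weight n s L j d :
  (0 < L)%nat -> (j < s)%nat -> (s * L < n)%nat -> solvable n (spider_adj s L) d ->
  1 <= rsum L (fun i => (1 / 2) ^ i * INR (d (j * L + i)%nat)) +
       (1 / 2) ^ L * rsum n (fun v => INR (d v)).
Proof.
  intros HL Hj Hn Hs. assert (Hjs : (j * L + L <= s * L)%nat) by nia.
  set (phi := fun v k => (1 / 2) ^ leg_dist L j v * INR k).
  assert (Htip : leg_dist L j (j * L) = O).
  { unfold leg_dist. rewrite Nat.leb_refl, (proj2 (Nat.ltb_lt (j * L) (j * L + L))) by lia.
    simpl; lia. }
  assert (H : phi (j * L)%nat 1%nat <= rsum n (fun v => phi v (d v))).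
  { apply (potential_bound n (spider_adj s L)).
    - lia.
    - apply spider_simple.
    - intros v k; unfold phi. apply Rmult_le_pos; [apply pow_le; lra|apply pos_INR].
    - intros k; unfold phi. rewrite S_INR.
      assert (A := half_pow_pos (leg_dist L j (j * L))). nra.
    - intros u v i k He. destruct (spider_edge _ _ _ _ _ He) as [_ Hnext].
      assert (Hd : (leg_dist L j u <= S (leg_dist L j v))%nat).
      { destruct Hnext as [->| ->]; apply leg_dist_next; auto. }
      unfold phi. rewrite !S_INR.
      assert (A : (1 / 2) ^ leg_dist L j v <= 2 * (1 / 2) ^ leg_dist L j u).
      { rewrite half_pow_S. apply Rmult_le_compat_l; [lra|].
        replace (S (leg_dist L j v)) with
          (leg_dist L j u + (S (leg_dist L j v) - leg_dist L j u))%nat by lia.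
        rewrite pow_add. rewrite <- (Rmult_1_r ((1 / 2) ^ leg_dist L j u)) at 2.
        apply Rmult_le_compat_l; [apply pow_le; lra|].
        apply Rle_trans with (1 ^ (S (leg_dist L j v) - leg_dist L j u));
          [apply pow_incr; lra|rewrite pow1; lra]. }
      nra.
    - apply Hs; lia. }
  unfold phi at 1 in H. rewrite Htip in H. simpl in H. rewrite !Rmult_1_r in H.
  eapply Rle_trans; [exact H|].
  apply Rle_trans with
    (rsum n (fun v => (if ((j * L <=? v)%nat && (v <? j * L + L)%nat)%bool
                       then (1 / 2) ^ (v - j * L) * INR (d v) else 0) +
                      (1 / 2) ^ L * INR (d v))).
  - apply rsum_le. intros v _. unfold phi, leg_dist.
    assert (A : 0 <= (1 / 2) ^ L * INR (d v)).
    { apply Rmult_le_pos; [apply pow_le; lra|apply pos_INR]. }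
    destruct ((j * L <=? v)%nat && (v <? j * L + L)%nat)%bool; lra.
  - rewrite rsum_plus, rsum_scal. apply Rplus_le_compat_r.
    replace n with (j * L + (L + (n - (j * L + L))))%nat by lia.
    rewrite rsum_app, rsum_app.
    rewrite (rsum_ext (j * L) _ (fun _ => 0)), rsum_const.
    2:{ intros i Hi. now rewrite (proj2 (Nat.leb_gt (j * L) i)) by lia. }
    rewrite (rsum_ext (n - (j * L + L)) _ (fun _ => 0)), rsum_const.
    2:{ intros i Hi. rewrite (proj2 (Nat.ltb_ge (j * L + (L + i)) (j * L + L))) by lia.
        now rewrite Bool.andb_false_r. }
    rewrite (rsum_ext L _ (fun i => (1 / 2) ^ i * INR (d (j * L + i)%nat))); [lra|].
    intros i Hi. rewrite (proj2 (Nat.leb_le (j * L) (j * L + i))) by lia.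
    rewrite (proj2 (Nat.ltb_lt (j * L + i) (j * L + L))) by lia.
    simpl. do 2 f_equal. lia.
Qed.

(** Indicator that some vertex of the leg holds more than its allowance [a i], written through a
    product so that its expectation is computed by [EM_prod]. *)
Definition leg_exceeds (L : nat) (a : nat -> nat) (d : distribution) : R :=
  1 - rprod L (fun i => if (d i <=? a i)%nat then 1 else 0).

Lemma leg_exceeds_bounds L a d : 0 <= leg_exceeds L a d <= 1.
Proof.
  unfold leg_exceeds.
  assert (A : 0 <= rprod L (fun i => if (d i <=? a i)%nat then 1 else 0)).
  { apply rprod_nonneg; intros i _; destruct (d i <=? a i)%nat; lra. }
  assert (B : rprod L (fun i => if (d i <=? a i)%nat then 1 else 0) <= rprod L (fun _ => 1)).
  { apply rprod_le; intros i _; destruct (d i <=? a i)%nat; lra. }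
  rewrite rprod_const, pow1 in B. lra.
Qed.

Lemma leg_exceeds_ext L a f g :
  (forall i, (i < L)%nat -> f i = g i) -> leg_exceeds L a f = leg_exceeds L a g.
Proof. intros H. unfold leg_exceeds. f_equal. apply rprod_ext; intros i Hi. now rewrite H. Qed.

Lemma EM_legs s L M q (B : distribution -> R) :
  (forall f g, (forall i, (i < L)%nat -> f i = g i) -> B f = B g) ->
  EM (s * L) M q (fun d => rprod s (fun j => B (fun i => d (j * L + i)%nat))) = EM L M q B ^ s.
Proof.
  intros HB; induction s as [|s IH]; [reflexivity|].
  replace (S s * L)%nat with (s * L + L)%nat by lia. cbn [rprod].
  rewrite (EM_block (s * L) L M q
    (fun d => rprod s (fun j => B (fun i => d (j * L + i)%nat))) B); auto.
  - cbn [pow]. rewrite <- IH. apply Rmult_comm.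
  - intros f g H. apply rprod_ext; intros j Hj. apply HB; intros i Hi. apply H; nia.
Qed.

(** A leg within its allowances has tip weight below 1/2 from its own pebbles, so its tip is out of
    reach unless the total number of pebbles is at least [2 ^ L / 2]. The total has mean at most
    [y], and Markov's inequality gives the first term. Otherwise all [s] independent legs exceed
    their allowances, which gives the second. *)
Lemma spider_solvable_prob n s L M y a :
  (0 < L)%nat -> (s * L < n)%nat -> 0 < y ->
  rsum L (fun i => (1 / 2) ^ i * INR (a i)) < 1 / 2 ->
  (forall i, (i < L)%nat -> (a i <= M)%nat) ->
  EM n M (ratio n y) (fun d => indicator (solvable n (spider_adj s L) d)) <=
  2 * (1 / 2) ^ L * y + (1 - rprod L (fun i => 1 - ratio n y ^ S (a i))) ^ s.
Proof.
  intros HL Hn Hy Ha HM. assert (Hq := ratio_bounds n y ltac:(lia) Hy).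
  assert (Hodds := ratio_odds n y ltac:(lia) Hy).
  set (q := ratio n y) in *.
  apply Rle_trans with (EM n M q (fun d => 2 * (1 / 2) ^ L * rsum n (fun v => INR (d v)) +
    rprod s (fun j => leg_exceeds L a (fun i => d (j * L + i)%nat)))).
  - apply EM_le; [lra|]. intros d.
    assert (H1 : 0 <= rsum n (fun v => INR (d v))) by (apply rsum_nonneg; intros; apply pos_INR).
    assert (H2 : 0 <= rprod s (fun j => leg_exceeds L a (fun i => d (j * L + i)%nat))).
    { apply rprod_nonneg; intros; apply leg_exceeds_bounds. }
    assert (H3 := half_pow_pos L).
    destruct (classic (solvable n (spider_adj s L) d)) as [Hs|Hs].
    2:{ rewrite indicator_false by auto. nra. }
    rewrite indicator_true by auto.
    destruct (Rle_lt_dec 1 (2 * (1 / 2) ^ L * rsum n (fun v => INR (d v)))) as [|Hlt]; [lra|].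
    rewrite (rprod_eq_1 s); [nra|].
    intros j Hj. unfold leg_exceeds.
    destruct (classic (forall i, (i < L)%nat -> (d (j * L + i) <= a i)%nat)) as [Hle|Hgt].
    + exfalso. assert (A := spider_tip_weight n s L j d HL Hj Hn Hs).
      assert (B : rsum L (fun i => (1 / 2) ^ i * INR (d (j * L + i)%nat)) <=
                  rsum L (fun i => (1 / 2) ^ i * INR (a i))).
      { apply rsum_le; intros i Hi. apply Rmult_le_compat_l; [apply pow_le; lra|].
        apply le_INR; auto. }
      lra.
    + apply not_all_ex_not in Hgt. destruct Hgt as [i Hi]. apply imply_to_and in Hi.
      destruct Hi as [Hi Hd]. rewrite (rprod_eq_0 L _ i); [lra|auto|].
      now rewrite (proj2 (Nat.leb_gt _ _)) by lia.
  - rewrite EM_plus. apply Rplus_le_compat.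
    + rewrite EM_scal. apply Rmult_le_compat_l; [assert (H3 := half_pow_pos L); lra|].
      apply Rle_trans with (rsum n (fun _ => y / INR n)).
      * apply (EM_sum_le n M q (fun _ a => INR a)); [lra| |].
        -- intros; apply pos_INR.
        -- intros i _. rewrite <- Hodds. apply gsum_id_le; lra.
      * rewrite rsum_const. right; field. apply not_0_INR; lia.
    + replace n with (s * L + (n - s * L))%nat by lia.
      eapply Rle_trans; [apply EM_extend_le; [lra| |]|].
      * intros f g H. apply rprod_ext; intros j Hj. apply leg_exceeds_ext.
        intros i Hi; apply H; nia.
      * intros d; apply rprod_nonneg; intros; apply leg_exceeds_bounds.
      * rewrite EM_legs by apply leg_exceeds_ext. apply pow_incr. split.
        { apply EM_nonneg; [lra|]. apply leg_exceeds_bounds. }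
        unfold leg_exceeds.
        rewrite (EM_ext _ _ _ _ (fun d => 1 + (-1) *
          rprod L (fun i => if (d i <=? a i)%nat then 1 else 0))) by (intros; ring).
        rewrite EM_plus, EM_scal.
        rewrite (EM_prod L M q (fun i b => if (b <=? a i)%nat then 1 else 0)).
        rewrite (rprod_ext L _ (fun i => 1 - q ^ S (a i)))
          by (intros; apply gsum_le_indicator; auto).
        assert (EM L M q (fun _ => 1) <= 1) by (apply EM_const_le; lra). lra.
Qed.

(** * Estimates *)

Lemma exp_pow_nat x m : exp x ^ m = exp (INR m * x).
Proof.
  induction m as [|m IH]; [simpl; rewrite Rmult_0_l, exp_0; auto|].
  rewrite S_INR. simpl pow. rewrite IH, <- exp_plus. f_equal; ring.
Qed.

(** From [2 ^ k <= exp k], [(1 - y) ^ m <= exp (- m y)] and [exp (-1) <= 1 / 2]. *)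
Lemma pow2_mul_pow_le_half k m y :
  0 <= y <= 1 -> INR k + 1 <= INR m * y -> 2 ^ k * (1 - y) ^ m <= 1 / 2.
Proof.
  intros Hy H.
  assert (H1 : 2 ^ k <= exp (INR k)).
  { rewrite <- (Rmult_1_r (INR k)), <- exp_pow_nat. apply pow_incr.
    assert (A := exp_ineq1_le 1). lra. }
  assert (H2 : (1 - y) ^ m <= exp (- (INR m * y))).
  { replace (- (INR m * y)) with (INR m * - y) by ring. rewrite <- exp_pow_nat.
    apply pow_incr. assert (A := exp_ineq1_le (- y)). lra. }
  assert (H3 : exp (-1) <= 1 / 2).
  { replace (-1) with (Ropp 1) by ring. rewrite exp_Ropp. assert (A := exp_ineq1_le 1).
    replace (1 / 2) with (/ 2) by field. apply Rinv_le_contravar; lra. }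
  apply Rle_trans with (exp (INR k) * exp (- (INR m * y))).
  - apply Rmult_le_compat; auto; apply pow_le; lra.
  - rewrite <- exp_plus. apply Rle_trans with (exp (-1)); auto.
    destruct (Req_dec (INR k + - (INR m * y)) (-1)) as [->|Hne]; [lra|].
    left; apply exp_increasing; lra.
Qed.

Lemma INR_pow2 k : INR (2 ^ k) = 2 ^ k.
Proof. now rewrite pow_INR. Qed.

Lemma half_pow_inv k : (1 / 2) ^ k = / 2 ^ k.
Proof. unfold Rdiv. now rewrite Rmult_1_l, pow_inv. Qed.

Lemma broom_threshold n L t x :
  (64 * 2 ^ L <= n)%nat -> 0 < t <= INR n ->
  INR n * 2 ^ L <= t * t <= 128 * (INR n * 2 ^ L) ->
  threshold n (spider_adj 1 L) x -> t / 512 <= x <= 512 * t.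
Proof.
  intros Hn Ht Ht2 Hx.
  assert (HL : (L < 2 ^ L)%nat) by (apply Nat.pow_gt_lin_r; lia).
  assert (Hn' := le_INR _ _ Hn). rewrite mult_INR, INR_pow2 in Hn'. simpl INR in Hn'.
  assert (Hw : 1 <= 2 ^ L) by (apply pow_R1_Rle; lra).
  set (w := 2 ^ L) in *. split.
  (* With mean [l = t / (64 n) <= 1 / 64] per vertex, the leg contributes at most [2 l <= 1 / 32].
     The leaves contribute at most [1 / 16], because [n l ^ 2 = t ^ 2 / (4096 n) <= 2 ^ L / 32]. *)
  - apply Rle_trans with (t / 64); [lra|].
    apply (threshold_ge n (spider_adj 1 L) x _ 0); auto; [lia|lra|]. intros M _.
    eapply Rle_trans; [apply broom_solvable_prob; [lia|lra]|].
    assert (Hr := ratio_bounds n (t / 64) ltac:(lia) ltac:(lra)).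
    set (l := t / 64 / INR n).
    assert (Hlt : l * INR n = t / 64) by (unfold l; field; lra).
    assert (Hl : 0 < l <= 1 / 64).
    { split; [apply Rdiv_lt_0_compat; lra|]. apply Rmult_le_reg_r with (INR n); lra. }
    assert (Hq : ratio n (t / 64) <= l).
    { unfold ratio, l. apply Rmult_le_compat_l; [lra|]. apply Rinv_le_contravar; lra. }
    set (q := ratio n (t / 64)) in *.
    assert (Hq2 : q ^ 2 <= l * l) by (simpl; nra).
    assert (He : q ^ 2 / (1 - q ^ 2) <= 2 * (l * l)).
    { assert (Hll : 0 <= l * l <= 1 / 2) by nra.
      apply Rmult_le_reg_r with (1 - q ^ 2); [lra|].
      unfold Rdiv. rewrite Rmult_assoc, Rinv_l, Rmult_1_r by lra. nra. }
    assert (Hnl : INR n * (l * l) <= w / 32).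
    { apply Rmult_le_reg_r with (INR n); [lra|].
      replace (INR n * (l * l) * INR n) with ((l * INR n) * (l * INR n)) by ring.
      rewrite Hlt. lra. }
    rewrite half_pow_inv. fold w.
    assert (Hiw : w * / w = 1) by (apply Rinv_r; lra).
    assert (0 < / w) by (apply Rinv_0_lt_compat; lra).
    assert (INR n * (/ w * (q ^ 2 / (1 - q ^ 2))) <= INR n * (/ w * (2 * (l * l)))).
    { apply Rmult_le_compat_l; [lra|]. apply Rmult_le_compat_l; lra. }
    assert (INR n * (/ w * (2 * (l * l))) <= 1 / 16).
    { replace (INR n * (/ w * (2 * (l * l)))) with (2 * / w * (INR n * (l * l))) by ring.
      apply Rle_trans with (2 * / w * (w / 32)); [apply Rmult_le_compat_l; lra|].
      right; field; lra. }
    lra.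
  (* At least [n / 2] leaves are available, so [n q ^ 2 >= 12 * 2 ^ L] makes the exponent at least
     [3 * 2 ^ L >= 2 ^ S L + 1]. For large [t] this follows from [q >= 3 / 4] and [n >= 64 * 2 ^ L],
     otherwise from [q >= 4 t / n]. *)
  - apply Rle_trans with (16 * t); [|lra].
    apply (threshold_le n (spider_adj 1 L) x _ Hx); [lra|]. intros M.
    assert (Hr := ratio_bounds n (16 * t) ltac:(lia) ltac:(lra)).
    eapply Rle_trans; [apply broom_unsolvable_prob; [lia|lra]|].
    apply pow2_mul_pow_le_half; [simpl; nra|].
    rewrite INR_pow2. change (2 ^ S L) with (2 * w).
    assert (Hm : INR n / 2 <= INR (n - S L)).
    { rewrite minus_INR by lia. assert (A := lt_INR _ _ HL). rewrite INR_pow2 in A.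
      fold w in A. rewrite S_INR. lra. }
    assert (Hq : 12 * w <= INR n * ratio n (16 * t) ^ 2).
    { destruct (Rle_lt_dec (3 * INR n) (16 * t)) as [Hc|Hc].
      - assert (3 / 4 <= ratio n (16 * t)).
        { unfold ratio. apply Rmult_le_reg_r with (INR n + 16 * t); [lra|].
          replace (16 * t / (INR n + 16 * t) * (INR n + 16 * t)) with (16 * t) by (field; lra).
          lra. }
        assert (9 / 16 <= ratio n (16 * t) ^ 2) by (simpl; nra). nra.
      - assert (4 * t / INR n <= ratio n (16 * t)).
        { unfold ratio. replace (4 * t / INR n) with (16 * t * / (4 * INR n)) by (field; lra).
          apply Rmult_le_compat_l; [lra|]. apply Rinv_le_contravar; lra. }
        assert (Hp : 0 <= 4 * t / INR n) by (apply Rle_mult_inv_pos; lra).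
        assert (Hs : (4 * t / INR n) ^ 2 <= ratio n (16 * t) ^ 2) by (apply pow_incr; lra).
        assert (INR n * (4 * t / INR n) ^ 2 <= INR n * ratio n (16 * t) ^ 2)
          by (apply Rmult_le_compat_l; lra).
        assert (16 * w <= INR n * (4 * t / INR n) ^ 2); [|lra].
        apply Rmult_le_reg_r with (INR n); [lra|].
        replace (INR n * (4 * t / INR n) ^ 2 * INR n) with (16 * (t * t)) by (field; lra). lra. }
    assert (0 <= ratio n (16 * t) ^ 2) by (apply pow_le; lra). nra.
Qed.

(** * The probability of a nearly empty leg *)

(** Bernoulli's inequality for [1 / q = 1 + 1 / l], cleared of denominators. *)
Lemma odds_pow_bound q l b : 0 < l -> q = l / (1 + l) -> q ^ b * (l + INR b) <= l.
Proof.
  intros Hl ->. induction b as [|b IH]; [simpl; lra|].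
  rewrite S_INR. simpl pow. set (c := (l / (1 + l)) ^ b) in *.
  assert (Hc : 0 <= c) by (apply pow_le; apply Rle_mult_inv_pos; lra).
  assert (Hb := pos_INR b).
  apply Rle_trans with (c * (l + INR b)); auto.
  replace (l / (1 + l) * c * (l + (INR b + 1))) with (c * (l / (1 + l) * (l + (INR b + 1)))) by ring.
  apply Rmult_le_compat_l; auto. apply Rmult_le_reg_r with (1 + l); [lra|].
  replace (l / (1 + l) * (l + (INR b + 1)) * (1 + l)) with (l * (l + (INR b + 1)))
    by (field; lra). nra.
Qed.

Lemma odds_pow_ge q l b c :
  0 < l -> q = l / (1 + l) -> 0 < c <= INR b -> c / (l + c) <= 1 - q ^ b.
Proof.
  intros Hl Hq Hc. assert (H := odds_pow_bound q l b Hl Hq).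
  assert (Hp : 0 <= q ^ b).
  { apply pow_le. rewrite Hq. apply Rle_mult_inv_pos; lra. }
  apply Rmult_le_reg_r with (l + c); [lra|].
  unfold Rdiv. rewrite Rmult_assoc, Rinv_l, Rmult_1_r by lra. nra.
Qed.

Lemma INR_div_bounds x y : (0 < y)%nat ->
  INR (x / y) <= INR x / INR y /\ INR x / INR y <= INR (S (x / y)).
Proof.
  intros Hy. assert (Hy' : 0 < INR y) by (apply lt_0_INR; auto).
  assert (A := Nat.Div0.mul_div_le x y).
  assert (B := Nat.mul_succ_div_gt x y ltac:(lia)).
  apply le_INR in A. apply lt_INR in B. rewrite mult_INR in A, B.
  split; apply Rmult_le_reg_r with (INR y); auto;
    unfold Rdiv; rewrite Rmult_assoc, Rinv_l, Rmult_1_r by lra; lra.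
Qed.

(* Bounds on the pebbles along a leg which keep the weight at its tip below 1/2: up to distance [k]
   each vertex contributes at most [1 / (8 k)], and the later contributions decay geometrically. *)
Definition leg_bound (k i : nat) : nat :=
  if (i <? k)%nat then (2 ^ i / (8 * k))%nat
  else (2 ^ k * 3 ^ (i - k) / (16 * 2 ^ (i - k)))%nat.

Lemma leg_bound_near k i : (i < k)%nat ->
  INR (leg_bound k i) <= 2 ^ i / (8 * INR k) /\ 2 ^ i / (8 * INR k) <= INR (S (leg_bound k i)).
Proof.
  intros Hi. unfold leg_bound. rewrite (proj2 (Nat.ltb_lt i k)) by auto.
  assert (H := INR_div_bounds (2 ^ i) (8 * k) ltac:(lia)).
  rewrite mult_INR, INR_pow2 in H. replace (INR 8) with 8 in H by (simpl; ring). auto.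
Qed.

Lemma leg_bound_far k j :
  INR (leg_bound k (k + j)) <= 2 ^ k * (3 / 2) ^ j / 16 /\
  2 ^ k * (3 / 2) ^ j / 16 <= INR (S (leg_bound k (k + j))).
Proof.
  unfold leg_bound. rewrite (proj2 (Nat.ltb_ge (k + j) k)) by lia.
  replace (k + j - k)%nat with j by lia.
  assert (Hp : (2 ^ j <> 0)%nat) by (apply Nat.pow_nonzero; lia).
  assert (H := INR_div_bounds (2 ^ k * 3 ^ j) (16 * 2 ^ j) ltac:(lia)).
  rewrite !mult_INR, !INR_pow2, pow_INR in H.
  replace (INR 16) with 16 in H by (simpl; ring). replace (INR 3) with 3 in H by (simpl; ring).
  replace (2 ^ k * (3 / 2) ^ j / 16) with (2 ^ k * 3 ^ j / (16 * 2 ^ j)); auto.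
  unfold Rdiv. rewrite Rpow_mult_distr, pow_inv. field. apply pow_nonzero; lra.
Qed.

(** The first [k] vertices weigh at most [1 / 8] in total and the others at most
    [(1 / 16) / (1 - 3 / 4) = 1 / 4]. The growth rate [3 / 2] of the far allowances is below 2, so
    that these weights are summable, and above 1, so that the probabilities of exceeding them are
    summable too. *)
Lemma leg_bound_weight k J : (0 < k)%nat ->
  rsum (k + J) (fun i => (1 / 2) ^ i * INR (leg_bound k i)) < 1 / 2.
Proof.
  intros Hk. assert (Hk' : 0 < INR k) by (apply lt_0_INR; auto).
  rewrite rsum_app.
  assert (A : rsum k (fun i => (1 / 2) ^ i * INR (leg_bound k i)) <=
              rsum k (fun _ => / (8 * INR k))).
  { apply rsum_le; intros i Hi. rewrite half_pow_inv.
    assert (0 < 2 ^ i) by (apply pow_lt; lra).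
    apply Rle_trans with (/ 2 ^ i * (2 ^ i / (8 * INR k))).
    - apply Rmult_le_compat_l; [left; apply Rinv_0_lt_compat; auto|].
      apply leg_bound_near; auto.
    - right; field. lra. }
  rewrite rsum_const in A.
  replace (INR k * / (8 * INR k)) with (1 / 8) in A by (field; lra).
  assert (B : rsum J (fun i => (1 / 2) ^ (k + i) * INR (leg_bound k (k + i))) <=
              rsum J (fun i => 1 / 16 * (3 / 4) ^ i)).
  { apply rsum_le; intros i Hi.
    apply Rle_trans with ((1 / 2) ^ (k + i) * (2 ^ k * (3 / 2) ^ i / 16)).
    - apply Rmult_le_compat_l; [apply pow_le; lra|]. apply leg_bound_far.
    - right. replace (3 / 4) with (1 / 2 * (3 / 2)) by field.
      rewrite Rpow_mult_distr, pow_add, (half_pow_inv k).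
      assert (2 ^ k <> 0) by (apply pow_nonzero; lra). field. auto. }
  assert (C := rsum_geom J (1 / 16) (3 / 4) ltac:(lra) ltac:(lra)). lra.
Qed.

(** [T] is [k (k - 1) / 2], specified without division. *)
Lemma rprod_pow2 k : exists T, (2 * T + k = k * k)%nat /\
  forall c, rprod k (fun i => 2 ^ i * c) = 2 ^ T * c ^ k.
Proof.
  induction k as [|k [T [HT IH]]].
  - exists O; split; [lia|]. intros; simpl; ring.
  - exists (T + k)%nat; split; [lia|]. intros c. cbn [rprod]. rewrite IH, pow_add. simpl; ring.
Qed.

(** For [i < k] the allowance is kept with probability at least [2 ^ i / (2 ^ k + 2 ^ i) >= 2 ^ (i -
    k - 1)], and the product of these is [2 ^ (- E)] because [k (k + 1) - k (k - 1) / 2 = E]. *)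
Lemma leg_prob_lower k J E q : (12 <= k)%nat -> (2 * E = k * k + 3 * k)%nat ->
  q = (2 ^ k / (8 * INR k)) / (1 + 2 ^ k / (8 * INR k)) ->
  1 / 2 * (1 / 2) ^ E <= rprod (k + J) (fun i => 1 - q ^ S (leg_bound k i)).
Proof.
  intros Hk HE Hq. assert (Hk' := le_INR _ _ Hk).
  replace (INR 12) with 12 in Hk' by (simpl; ring).
  assert (H2k : 0 < 2 ^ k) by (apply pow_lt; lra).
  set (l := 2 ^ k / (8 * INR k)) in *.
  assert (Hl : 0 < l) by (apply Rdiv_lt_0_compat; lra).
  rewrite rprod_app, Rmult_comm. apply Rmult_le_compat; try (apply pow_le; lra); try lra.
  - apply Rle_trans with (rprod k (fun i => 2 ^ i * (1 / 2) ^ S k)).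
    + destruct (rprod_pow2 k) as [T [HT HP]]. rewrite HP, <- pow_mult.
      right. replace (S k * k)%nat with (E + T)%nat by nia.
      rewrite pow_add, (half_pow_inv T).
      assert (2 ^ T <> 0) by (apply pow_nonzero; lra). field. auto.
    + apply rprod_le; intros i Hi. split.
      { apply Rmult_le_pos; apply pow_le; lra. }
      assert (H2i : 0 < 2 ^ i) by (apply pow_lt; lra).
      destruct (leg_bound_near k i Hi) as [_ Hb].
      eapply Rle_trans; [|apply (odds_pow_ge q l _ (2 ^ i / (8 * INR k)) Hl Hq);
        split; [apply Rdiv_lt_0_compat; lra|exact Hb]].
      unfold l. replace (2 ^ i / (8 * INR k) / (2 ^ k / (8 * INR k) + 2 ^ i / (8 * INR k)))
        with (2 ^ i / (2 ^ k + 2 ^ i)) by (field; lra).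
      apply Rmult_le_compat_l; [lra|]. rewrite half_pow_inv. apply Rinv_le_contravar; [lra|].
      assert (2 ^ i <= 2 ^ k) by (apply Rle_pow; [lra|lia]). simpl; lra.
  (* [e j] is the mean divided by the allowance and bounds the probability of exceeding it; these
     sum to at most [6 / k <= 1 / 2], whence [k >= 12]. *)
  - set (e := fun j => 2 / INR k * (2 / 3) ^ j).
    assert (Hik : 0 < / INR k <= / 12).
    { split; [apply Rinv_0_lt_compat; lra|apply Rinv_le_contravar; lra]. }
    assert (He : forall j, 0 <= e j <= 1).
    { intros j; unfold e. assert (0 <= (2 / 3) ^ j <= 1 ^ j).
      { split; [apply pow_le; lra|apply pow_incr; lra]. }
      rewrite pow1 in *. unfold Rdiv at 1 3. split; [apply Rmult_le_pos; lra|].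
      nra. }
    apply Rle_trans with (rprod J (fun j => 1 - e j)).
    + assert (A := rprod_one_sub J e (fun j _ => He j)).
      assert (B := rsum_geom J (2 / INR k) (2 / 3)). fold e in B.
      assert (2 / INR k / (1 - 2 / 3) <= 1 / 2).
      { replace (2 / INR k / (1 - 2 / 3)) with (6 * / INR k) by (field; lra). lra. }
      assert (0 <= 2 / INR k) by (unfold Rdiv; lra). lra.
    + apply rprod_le; intros j _. destruct (He j) as [He0 He1]. split; [lra|].
      destruct (leg_bound_far k j) as [_ Hb].
      set (c := 2 ^ k * (3 / 2) ^ j / 16) in *.
      assert (H32 : 0 < (3 / 2) ^ j) by (apply pow_lt; lra).
      assert (Hc : 0 < c) by (unfold c; nra).
      eapply Rle_trans; [|apply (odds_pow_ge q l _ c Hl Hq); split; [auto|exact Hb]].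
      assert (Hec : e j * c = l).
      { unfold e, c, l. replace (2 / 3) with (/ (3 / 2)) by field. rewrite pow_inv.
        field. lra. }
      apply Rmult_le_reg_r with (l + c); [lra|].
      unfold Rdiv. rewrite Rmult_assoc, Rinv_l, Rmult_1_r by lra. nra.
Qed.

(** Once [s * p >= 3], the probability that none of [s] independent legs is nearly empty is at most
    [1 / 4]. *)
Lemma one_sub_pow_bound p s : 0 <= p <= 1 -> (1 - p) ^ s * (1 + INR s * p) <= 1.
Proof.
  intros Hp; induction s as [|s IH]; [simpl; lra|].
  rewrite S_INR. simpl pow. assert (Hs := pos_INR s).
  assert (Hc : 0 <= (1 - p) ^ s) by (apply pow_le; lra). set (c := (1 - p) ^ s) in *.
  apply Rle_trans with (c * (1 + INR s * p)); auto.
  replace ((1 - p) * c * (1 + (INR s + 1) * p)) with (c * ((1 - p) * (1 + (INR s + 1) * p)))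
    by ring.
  apply Rmult_le_compat_l; nra.
Qed.

(** Used with [r = 16 + j], where the leg length is less than [(r + 1) ^ 2 + 3]. *)
Lemma quadratic_le_pow4 j : (12 * ((17 + j) * (17 + j) + 3) <= 2 ^ (13 + 2 * j))%nat.
Proof.
  induction j as [|j IH].
  - apply Nat.leb_le; vm_compute; reflexivity.
  - replace (13 + 2 * S j)%nat with (S (S (13 + 2 * j))) by lia.
    rewrite !Nat.pow_succ_r'. nia.
Qed.

Lemma spider_threshold n r E k :
  (16 <= r)%nat -> (k + 4 = r)%nat -> (r * r <= 2 * Nat.log2 n + 2 < S r * S r)%nat ->
  (2 * E = k * k + 3 * k)%nat ->
  let L := (2 * Nat.log2 n + 5)%nat in let s := ((n - 1) / L)%nat in
  (s * L < n)%nat /\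
  forall x, threshold n (spider_adj s L) x -> INR n * (2 ^ k / (8 * INR k)) <= x.
Proof.
  intros Hr Hk Hr2 HE L s. set (l := Nat.log2 n) in *.
  assert (Hn0 : (0 < n)%nat).
  { destruct n; [|lia]. unfold l in Hr2. simpl in Hr2. nia. }
  destruct (Nat.log2_spec n Hn0) as [Hlo Hhi]. fold l in Hlo, Hhi.
  assert (Hs : (s * L < n)%nat).
  { unfold s. assert (A := Nat.Div0.mul_div_le (n - 1) L). lia. }
  split; auto. intros x Hx.
  (* For [k = r - 4] one has [2 E = r ^ 2 - 5 r + 4], while [r ^ 2 <= 2 l + 2]. The shift by 4 thus
     leaves a factor [2 ^ (2 r - 3)] between [2 ^ E] and [2 ^ l], which absorbs [12 L], a quantity
     of order [r ^ 2]. *)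
  assert (HEl : (E + 2 * r <= l + 3)%nat) by nia.
  assert (Hkl : (k <= l)%nat) by nia.
  assert (HE2 : (12 * L * 2 ^ E <= 2 ^ l)%nat).
  { assert (A := quadratic_le_pow4 (r - 16)).
    assert (B : (12 * L <= 2 ^ (2 * r - 3))%nat).
    { apply Nat.le_trans with (2 ^ (13 + 2 * (r - 16)))%nat.
      - eapply Nat.le_trans; [|exact A]. replace (17 + (r - 16))%nat with (S r) by lia.
        unfold L. lia.
      - apply Nat.pow_le_mono_r; lia. }
    apply Nat.le_trans with (2 ^ (2 * r - 3) * 2 ^ E)%nat.
    - apply Nat.mul_le_mono_r; auto.
    - rewrite <- Nat.pow_add_r. apply Nat.pow_le_mono_r; lia. }
  assert (HsE : (6 * 2 ^ E <= s)%nat).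
  { unfold s. apply Nat.div_le_lower_bound; [unfold L; lia|].
    assert (2 ^ E <> 0)%nat by (apply Nat.pow_nonzero; lia).
    assert (0 < L)%nat by (unfold L; lia). nia. }
  assert (Hk12 : (12 <= k)%nat) by lia.
  assert (Hk' := le_INR _ _ Hk12). replace (INR 12) with 12 in Hk' by (simpl; ring).
  assert (H2k : 0 < 2 ^ k) by (apply pow_lt; lra).
  assert (Hn' : 1 <= INR n) by (apply (le_INR 1); lia).
  set (lam := 2 ^ k / (8 * INR k)).
  assert (Hlam : 0 < lam) by (apply Rdiv_lt_0_compat; lra).
  assert (Hbound : exists N, forall i, (i < L)%nat -> (leg_bound k i <= N)%nat).
  { generalize (leg_bound k). intros a. clear. induction L as [|m [N HN]].
    - exists O; intros; lia.
    - exists (N + a m)%nat; intros i Hi. destruct (Nat.eq_dec i m) as [->|]; [lia|].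
      specialize (HN i ltac:(lia)); lia. }
  destruct Hbound as [N HN].
  assert (HLk : L = (k + (L - k))%nat) by (unfold L; lia).
  apply (threshold_ge n (spider_adj s L) x _ N); auto; [nra|]. intros M HM.
  eapply Rle_trans; [apply (spider_solvable_prob n s L M _ (leg_bound k)); auto|].
  - unfold L; lia.
  - nra.
  - rewrite HLk. apply leg_bound_weight; lia.
  - intros i Hi; specialize (HN i Hi); lia.
  - apply Rle_trans with (1 / 4 + 1 / 4); [|lra]. apply Rplus_le_compat.
    (* The length [L] is chosen for this term: [2 ^ L = 8 * (2 ^ S l) ^ 2 >= 8 n ^ 2], whereas
       [n * lam <= n ^ 2]. *)
    + assert (Hlam2 : lam <= INR n).
      { apply Rle_trans with (2 ^ k).
        - unfold lam. apply Rmult_le_reg_r with (8 * INR k); [lra|].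
          unfold Rdiv. rewrite Rmult_assoc, Rinv_l; nra.
        - rewrite <- INR_pow2. apply le_INR. eapply Nat.le_trans; [|exact Hlo].
          apply Nat.pow_le_mono_r; lia. }
      assert (HnL : INR n <= 2 ^ S l).
      { rewrite <- INR_pow2. apply le_INR; lia. }
      rewrite half_pow_inv. assert (H2L : 0 < 2 ^ L) by (apply pow_lt; lra).
      assert (HLe : 2 ^ L = 8 * (2 ^ S l * 2 ^ S l)).
      { unfold L. replace (2 * l + 5)%nat with (3 + (S l + S l))%nat by lia.
        rewrite !pow_add. simpl; ring. }
      apply Rmult_le_reg_r with (2 ^ L); auto.
      replace (2 * / 2 ^ L * (INR n * lam) * 2 ^ L) with (2 * (INR n * lam)) by (field; lra).
      rewrite HLe.
      assert (INR n * lam <= INR n * INR n) by (apply Rmult_le_compat_l; lra).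
      assert (INR n * INR n <= 2 ^ S l * 2 ^ S l) by (apply Rmult_le_compat; lra). lra.
    + set (q := ratio n (INR n * lam)).
      assert (Hq : q = lam / (1 + lam)).
      { unfold q, ratio. field. nra. }
      assert (HP := leg_prob_lower k (L - k) E q Hk12 HE Hq). rewrite <- HLk in HP.
      set (P := rprod L (fun i => 1 - q ^ S (leg_bound k i))) in *.
      assert (Hq01 : 0 < q < 1) by (apply ratio_bounds; [lia|nra]).
      assert (HP1 : P <= 1).
      { apply Rle_trans with (rprod L (fun _ => 1)).
        - apply rprod_le. intros i _. apply mass_bounds; lra.
        - rewrite rprod_const, pow1; lra. }
      assert (HP0 : 0 < (1 / 2) ^ E) by apply half_pow_pos.
      (* There are at least [6 * 2 ^ E] legs, each nearly empty with probability at least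
         [2 ^ (- E) / 2]. *)
      assert (HsP : 3 <= INR s * P).
      { apply le_INR in HsE. rewrite mult_INR, INR_pow2 in HsE.
        replace (INR 6) with 6 in HsE by (simpl; ring).
        assert (0 < 2 ^ E) by (apply pow_lt; lra).
        apply Rle_trans with (6 * 2 ^ E * (1 / 2 * (1 / 2) ^ E)).
        - rewrite half_pow_inv. right; field. lra.
        - apply Rmult_le_compat; lra. }
      assert (A := one_sub_pow_bound P s ltac:(lra)).
      assert (B : 0 <= (1 - P) ^ s) by (apply pow_le; lra). nra.
Qed.

Lemma log2_bounds n : (1 <= n)%nat ->
  INR (Nat.log2 n) <= log2 (INR n) <= INR (Nat.log2 n) + 1.
Proof.
  intros Hn. destruct (Nat.log2_spec n ltac:(lia)) as [A B].
  assert (Hl2 : 0 < ln 2) by (rewrite <- ln_1; apply ln_increasing; lra).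
  assert (Hn' : 1 <= INR n) by (apply (le_INR 1); lia).
  assert (Hmono : forall a b, 0 < a -> a <= b -> ln a <= ln b).
  { intros a b Ha [H|H]; [left; apply ln_increasing; auto|right; congruence]. }
  apply le_INR in A. apply lt_INR in B. rewrite INR_pow2 in A, B.
  unfold log2. split; apply Rmult_le_reg_r with (ln 2); auto;
    unfold Rdiv; rewrite Rmult_assoc, Rinv_l, Rmult_1_r by lra.
  - rewrite <- ln_pow by lra. apply Hmono; auto. apply pow_lt; lra.
  - rewrite <- S_INR, <- ln_pow by lra. apply Hmono; lra.
Qed.

(** Since [2 log2 n <= 2 l + 2 < (r + 1) ^ 2] and [log2 n >= r ^ 2 / 4], the left side is at most
    [2 ^ (r + 1) / (r / 2) = 64 * 2 ^ k / r]. With the 8 in the mean [2 ^ k / (8 k)], this is where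
    512 comes from. *)
Lemma max_threshold_bound n r k :
  (5 <= r)%nat -> (k + 4 = r)%nat -> (r * r <= 2 * Nat.log2 n + 2 < S r * S r)%nat ->
  Rpower 2 (sqrt (2 * log2 (INR n))) / sqrt (log2 (INR n)) <= 512 * (2 ^ k / (8 * INR k)).
Proof.
  intros Hr Hk [Hlo Hhi].
  assert (Hn : (1 <= n)%nat).
  { destruct n; [|lia]. simpl in Hlo. nia. }
  destruct (log2_bounds n Hn) as [A B]. set (l := Nat.log2 n) in *.
  set (g := log2 (INR n)) in *.
  apply le_INR in Hlo. apply lt_INR in Hhi.
  rewrite !plus_INR, !mult_INR in Hlo, Hhi. rewrite (S_INR r) in Hhi.
  replace (INR 2) with 2 in Hlo, Hhi by (simpl; ring).
  assert (Hr' := le_INR _ _ Hr). replace (INR 5) with 5 in Hr' by (simpl; ring).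
  assert (Hrk : INR r = INR k + 4).
  { rewrite <- Hk, plus_INR. simpl; ring. }
  assert (H1 : sqrt (2 * g) <= INR r + 1).
  { rewrite <- (sqrt_square (INR r + 1)) by lra. apply sqrt_le_1_alt; lra. }
  assert (H2 : INR r / 2 <= sqrt g).
  { rewrite <- (sqrt_square (INR r / 2)) by lra. apply sqrt_le_1_alt. nra. }
  assert (H3 : Rpower 2 (sqrt (2 * g)) <= 2 ^ S r).
  { rewrite <- Rpower_pow by lra. apply Rle_Rpower; [lra|]. rewrite S_INR; auto. }
  assert (H4 : 2 ^ S r = 32 * 2 ^ k).
  { rewrite <- Hk. replace (S (k + 4)) with (k + 5)%nat by lia. rewrite pow_add; simpl; ring. }
  assert (H2k : 0 < 2 ^ k) by (apply pow_lt; lra).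
  apply Rle_trans with (2 ^ S r / (INR r / 2)).
  - apply Rmult_le_compat; auto.
    + left; apply exp_pos.
    + left; apply Rinv_0_lt_compat; lra.
    + apply Rinv_le_contravar; lra.
  - rewrite H4. replace (32 * 2 ^ k / (INR r / 2)) with (64 * 2 ^ k * / INR r) by (field; lra).
    replace (512 * (2 ^ k / (8 * INR k))) with (64 * 2 ^ k * / INR k) by (field; lra).
    apply Rmult_le_compat_l; [lra|]. apply Rinv_le_contravar; lra.
Qed.

Lemma pow2_bracket z : 1 <= z -> exists L, 2 ^ L <= z < 2 ^ S L.
Proof.
  intros Hz. destruct (Pow_x_infinity 2 ltac:(rewrite Rabs_right; lra) (z + 1)) as [B HB].
  specialize (HB B (le_n B)). rewrite Rabs_right in HB by (left; apply pow_lt; lra).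
  assert (Hlt : z < 2 ^ B) by lra. clear HB.
  induction B as [|B IH]; [simpl in Hlt; lra|].
  destruct (Rle_lt_dec (2 ^ B) z) as [H|H]; [now exists B|auto].
Qed.

(** * Small and large numbers of vertices *)

Definition attained (n : nat) (K : R) : Prop :=
  0 < K /\ forall t, sqrt (INR n) <= t ->
    t <= Rpower 2 (sqrt (2 * log2 (INR n))) / sqrt (log2 (INR n)) * INR n ->
    exists adj, simple_graph n adj /\ connected n adj /\
      exists x, is_geom_threshold n adj x /\ t / K <= x <= K * t.

Lemma attained_mono n K K' : (1 <= n)%nat -> K <= K' -> attained n K -> attained n K'.
Proof.
  intros Hn HK [H0 H]. split; [lra|]. intros t Ht Ht'.
  destruct (H t Ht Ht') as [adj [Hg [Hc [x [Hx Hb]]]]].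
  exists adj; split; [auto|split; [auto|]]. exists x; split; [auto|].
  assert (0 <= t) by (eapply Rle_trans; [apply sqrt_pos|exact Ht]).
  split.
  - apply Rle_trans with (t / K); [|lra]. apply Rmult_le_compat_l; auto.
    apply Rinv_le_contravar; lra.
  - apply Rle_trans with (K * t); [lra|]. apply Rmult_le_compat_r; auto.
Qed.

(** For fixed [n] the range of [t] is bounded and lies above 1, so a single graph serves all [t],
    with a constant depending on [n]. Only finitely many [n] are treated this way. *)
Lemma attained_some n : (1 <= n)%nat -> exists K, attained n K.
Proof.
  intros Hn. assert (Hn' : 1 <= INR n) by (apply (le_INR 1); auto).
  destruct (threshold_exists n complete_adj Hn (complete_simple n) (complete_connected n))
    as [x [Hx [Hthr _]]].
  set (T := Rpower 2 (sqrt (2 * log2 (INR n))) / sqrt (log2 (INR n)) * INR n).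
  assert (HT : 0 <= Rabs T / x) by (apply Rle_mult_inv_pos; [apply Rabs_pos|auto]).
  exists (Rabs T / x + x + 1). split; [lra|]. intros t Ht HtT.
  assert (H1 : 1 <= t).
  { apply Rle_trans with (sqrt (INR n)); auto. rewrite <- sqrt_1 at 1.
    now apply sqrt_le_1_alt. }
  exists complete_adj. split; [apply complete_simple|split; [apply complete_connected|]].
  exists x; split; auto. split; [|nra].
  apply Rmult_le_reg_r with (Rabs T / x + x + 1); [lra|].
  unfold Rdiv at 1. rewrite Rmult_assoc, Rinv_l, Rmult_1_r by lra.
  apply Rle_trans with (Rabs T); [fold T in HtT; assert (A := Rle_abs T); lra|].
  replace (x * (Rabs T / x + x + 1)) with (Rabs T + x * (x + 1)) by (field; lra). nra.
Qed.

Lemma attained_below B : exists K, forall n, (1 <= n < B)%nat -> attained n K.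
Proof.
  induction B as [|B [K HK]]; [exists 1; intros; lia|].
  destruct (le_lt_dec 1 B) as [HB|HB].
  - destruct (attained_some B HB) as [K' HK']. exists (Rmax K K'). intros n Hn.
    destruct (Nat.eq_dec n B) as [->|].
    + apply (attained_mono B K'); auto. apply Rmax_r.
    + apply (attained_mono n K); [lia|apply Rmax_l|]. apply HK; lia.
  - exists K; intros; lia.
Qed.

Lemma attained_large n : (200 <= Nat.log2 n)%nat -> attained n 512.
Proof.
  intros Hl. assert (Hn64 : (64 <= n)%nat).
  { assert (A := Nat.log2_le_lin n ltac:(lia)). lia. }
  assert (Hn : (1 <= n)%nat) by lia.
  assert (Hn' := le_INR _ _ Hn64). replace (INR 64) with 64 in Hn'
    by (rewrite INR_IZR_INZ; reflexivity).
  split; [lra|]. intros t Ht HtT.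
  assert (Ht0 : 0 < t).
  { apply Rlt_le_trans with (sqrt (INR n)); auto. apply sqrt_lt_R0; lra. }
  assert (Htt : INR n <= t * t).
  { rewrite <- (sqrt_sqrt (INR n)) by lra. apply Rmult_le_compat; auto; apply sqrt_pos. }
  destruct (Rle_lt_dec t (INR n)) as [Hle|Hgt].
  - assert (HL : exists L, (64 * 2 ^ L <= n)%nat /\
               INR n * 2 ^ L <= t * t <= 128 * (INR n * 2 ^ L)).
    (* [2 ^ L] is the power of two just below [t ^ 2 / (64 n)], or 1 when that quotient is at most
       2; [t <= n] then gives [64 * 2 ^ L <= n]. *)
    { destruct (Rle_lt_dec (t * t) (128 * INR n)) as [Hs|Hs].
      - exists O; split; [simpl; lia|simpl; lra].
      - destruct (pow2_bracket (t * t / (64 * INR n))) as [L [H1 H2]].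
        + apply Rmult_le_reg_r with (64 * INR n); [lra|].
          replace (t * t / (64 * INR n) * (64 * INR n)) with (t * t) by (field; lra). lra.
        + assert (E : t * t / (64 * INR n) * (64 * INR n) = t * t) by (field; lra).
          apply Rmult_le_compat_r with (r := 64 * INR n) in H1; [|lra].
          apply Rmult_lt_compat_r with (r := 64 * INR n) in H2; [|lra].
          rewrite E in H1, H2. simpl in H2.
          assert (0 < 2 ^ L) by (apply pow_lt; lra).
          exists L; split; [|split; nra].
          apply INR_le. rewrite mult_INR, INR_pow2.
          replace (INR 64) with 64 by (rewrite INR_IZR_INZ; reflexivity).
          apply Rmult_le_reg_r with (INR n); [lra|]. nra. }
    destruct HL as [L [HL Ht2]].
    assert (HLn : (L < n)%nat).
    { assert (L < 2 ^ L)%nat by (apply Nat.pow_gt_lin_r; lia). lia. }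
    assert (Hc : connected n (spider_adj 1 L)) by (apply spider_connected; lia).
    destruct (threshold_exists n (spider_adj 1 L) Hn (spider_simple n 1 L) Hc) as [x Hx].
    exists (spider_adj 1 L). split; [apply spider_simple|split; [auto|]].
    exists x; split; [apply Hx|]. apply (broom_threshold n L); auto.
  - set (r := Nat.sqrt (2 * Nat.log2 n + 2)).
    assert (Hr2 : (r * r <= 2 * Nat.log2 n + 2 < S r * S r)%nat) by apply Nat.sqrt_spec'.
    (* The cutoff 200 on [log2 n] is ample for this bound, which also makes [k >= 12]. *)
    assert (Hr : (16 <= r)%nat) by nia.
    set (k := (r - 4)%nat). assert (Hk : (k + 4 = r)%nat) by lia.
    destruct (rprod_pow2 k) as [T [HT _]].
    destruct (spider_threshold n r (T + 2 * k)%nat k Hr Hk Hr2 ltac:(lia)) as [Hs Hx].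
    cbv zeta in Hx.
    set (L := (2 * Nat.log2 n + 5)%nat) in *. set (s := ((n - 1) / L)%nat) in *.
    assert (Hc : connected n (spider_adj s L)) by (apply spider_connected; auto).
    destruct (threshold_exists n (spider_adj s L) Hn (spider_simple n s L) Hc) as [x Hthr].
    assert (Hmax := max_threshold_bound n r k ltac:(lia) Hk Hr2).
    destruct (threshold_interpolation n (spider_adj s L) x t (1 / 512)) as
      [adj [x' [Hg' [Hc' [Hthr' Hb]]]]]; auto; try lra.
    + apply spider_simple.
    + specialize (Hx x Hthr).
      apply Rmult_le_compat_r with (r := INR n) in Hmax; [|lra]. lra.
    + exists adj; split; [auto|split; [auto|]]. exists x'; split; [apply Hthr'|]. lra.
Qed.

Theorem theorem28 :
  exists K : R, 1 < K /\
    forall (n : nat), (2 <= n)%nat ->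
    forall t : R,
      sqrt (INR n) <= t ->
      t <= Rpower 2 (sqrt (2 * log2 (INR n))) / sqrt (log2 (INR n)) * INR n ->
      exists adj : nat -> nat -> bool,
        simple_graph n adj /\ connected n adj /\
        exists x : R, is_geom_threshold n adj x /\ t / K <= x <= K * t.
Proof.
  destruct (attained_below (2 ^ 200)) as [K HK].
  exists (Rmax K 512). split.
  { apply Rlt_le_trans with 512; [lra|apply Rmax_r]. }
  intros n Hn.
  assert (H : attained n (Rmax K 512)); [|apply H].
  destruct (le_lt_dec 200 (Nat.log2 n)) as [Hl|Hl].
  - apply (attained_mono n 512); [lia|apply Rmax_r|]. now apply attained_large.
  - apply (attained_mono n K); [lia|apply Rmax_l|]. apply HK. split; [lia|].
    apply Nat.log2_lt_pow2; auto; lia.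
Qed.
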